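(* Let $A=\mathcal{O}_q(\mathrm{SU}(2))$ with its right coaction $\Delta_A$ of $H=\mathbb{C}[t,t^{-1}]$, and let $\Omega^\bullet(A)=A\oplus\Omega^1(A)\oplus\Omega^2(A)\oplus\Omega^3(A)$ and $\Omega^\bullet(H)$ be the differential calculi described in the context. Then $\Omega^\bullet(A)$ is a complete differential calculus, i.e. $\Delta_A$ extends to a morphism of differential graded algebras $\Delta_A^\wedge:\Omega^\bullet(A)\to\Omega^\bullet(A)\otimes\Omega^\bullet(H)$.
   Context: A differential calculus on an algebra $A$ is a differential $\mathbb{N}_0$-graded algebra $(\Omega^\bullet,\wedge,\mathrm{d})$ (so $\mathrm{d}^2=0$ and the graded Leibniz rule holds) with $\Omega^0=A$ and $\Omega^k=\mathrm{span}\{a^0\mathrm{d}a^1\wedge\cdots\wedge\mathrm{d}a^k\}$. Tensor products of differential graded algebras carry the product $(\omega\otimes\eta)(\omega'\otimes\eta')=(-1)^{|\eta||\omega'|}(\omega\wedge\omega')\otimes(\eta\wedge\eta')$ and the differential $\omega\otimes\eta\mapsto \mathrm{d}\omega\otimes\eta+(-1)^{|\omega|}\omega\otimes\mathrm{d}\eta$. For a right $H$-comodule algebra $(A,\Delta_A)$ and a given calculus $\Omega^\bullet(H)$, a calculus $\Omega^\bullet(A)$ is complete if $\Delta_A$ extends to a morphism of differential graded algebras $\Omega^\bullet(A)\to\Omega^\bullet(A)\otimes\Omega^\bullet(H)$. Let $q\in\mathbb{C}$ be a nonzero deformation parameter. The Hopf algebra $H=\mathcal{O}(\mathrm{U}(1))=\mathbb{C}[t,t^{-1}]$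 has $\Delta(t)=t\otimes t$, $\epsilon(t)=1$, $S(t)=t^{-1}$; its calculus has $\Omega^1(H)=H\,\mathrm{d}t$ free of rank one with $\mathrm{d}t\,t=q^2t\,\mathrm{d}t$, and $\Omega^k(H)=0$ for $k\geq2$. $A=\mathcal{O}_q(\mathrm{SU}(2))$ is the algebra generated by $\alpha,\beta,\gamma,\delta$ with relations $\beta\alpha=q\alpha\beta$, $\gamma\alpha=q\alpha\gamma$, $\delta\beta=q\beta\delta$, $\delta\gamma=q\gamma\delta$, $\gamma\beta=\beta\gamma$, $\delta\alpha-\alpha\delta=(q-q^{-1})\beta\gamma$, $\alpha\delta-q^{-1}\beta\gamma=1$. The coaction is the algebra map with $\Delta_A(\alpha)=\alpha\otimes t$, $\Delta_A(\beta)=\beta\otimes t^{-1}$, $\Delta_A(\gamma)=\gamma\otimes t$, $\Delta_A(\delta)=\delta\otimes t^{-1}$. Write $|f|$ for the degree defined by $\Delta_A(f)=f\otimes t^{|f|}$; so $|\alpha|=|\gamma|=1$, $|\beta|=|\delta|=-1$. $\Omega^1(A)$ is the free left $A$-module on $e^+=q^{-1}\alpha\mathrm{d}\gamma-q^{-2}\gamma\mathrm{d}\alpha$, $e^-=\delta\mathrm{d}\beta-q\beta\mathrm{d}\delta$, $e^0=\delta\mathrm{d}\alpha-q\beta\mathrm{d}\gamma$, with $e^{\pm}f=q^{|f|}fe^{\pm}$, $e^0f=q^{2|f|}fe^0$ for $f\in\{\alpha,\beta,\gamma,\delta\}$; equivalently $\mathrm{d}\alpha=\alpha e^0+q\beta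 e^+$, $\mathrm{d}\beta=\alpha e^--q^{-2}\beta e^0$, $\mathrm{d}\gamma=\gamma e^0+q\delta e^+$, $\mathrm{d}\delta=\gamma e^--q^{-2}\delta e^0$. $\Omega^2(A)$ is the free left $A$-module on $e^+\wedge e^-,\ e^+\wedge e^0,\ e^-\wedge e^0$ with $e^+\wedge e^-=-q^{-2}e^-\wedge e^+$, $e^\pm\wedge e^0=-q^{\mp4}e^0\wedge e^\pm$, $e^\pm\wedge e^\pm=e^0\wedge e^0=0$, $\mathrm{d}e^0=q^3e^+\wedge e^-$, $\mathrm{d}e^\pm=\mp q^{\pm2}[2]_{q^{-2}}e^\pm\wedge e^0$, where $[2]_{q^{-2}}=1+q^{-2}$. $\Omega^3(A)$ is the free left $A$-module on $e^+\wedge e^-\wedge e^0$, and $\Omega^k(A)=0$ for $k>3$. *)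

(* Defs.v *)
From HB Require Import structures.
From mathcomp Require Import all_boot all_order all_algebra.
From mathcomp Require Import boolp classical_sets reals.
From mathcomp Require Export complex.

Set Implicit Arguments.
Unset Strict Implicit.
Unset Printing Implicit Defensive.
Import GRing.Theory.
Local Open Scope quotient_scope.
Local Open Scope ring_scope.

Definition bilin (K : fieldType) (U V W : lmodType K) (f : U -> V -> W) : Prop :=
  (forall v, linear (f^~ v)) /\ (forall u, linear (f u)).

Section BilinTheory.
Variables (K : fieldType) (U V W : lmodType K) (f : U -> V -> W).
Hypothesis fB : bilin f.

Lemma bilin0l v : f 0 v = 0.
Proof.
have := fB.1 v (-1) 0 0; rewrite /= scaler0 addr0 scaleN1r.
by rewrite addNr.
Qed.

Lemma bilin0r u : f u 0 = 0.
Proof.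
have := fB.2 u (-1) 0 0; rewrite /= scaler0 addr0 scaleN1r.
by rewrite addNr.
Qed.

Lemma bilinZl a u v : f (a *: u) v = a *: f u v.
Proof. by have := fB.1 v a u 0; rewrite /= !addr0 bilin0l addr0. Qed.

Lemma bilinZr a u v : f u (a *: v) = a *: f u v.
Proof. by have := fB.2 u a v 0; rewrite /= !addr0 bilin0r addr0. Qed.

Lemma bilinDl u u' v : f (u + u') v = f u v + f u' v.
Proof. by have := fB.1 v 1 u u'; rewrite /= !scale1r. Qed.

Lemma bilinDr u v v' : f u (v + v') = f u v + f u v'.
Proof. by have := fB.2 u 1 v v'; rewrite /= !scale1r. Qed.
End BilinTheory.

(* The tensor product U (x) V over K: formal finite sums of pairs (u, v), two
   of them being identified when every bilinear map takes the same value on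
   them.  [tliftE] and [tlift_linear] give the universal property. *)
Section Tensor.
Variables (K : fieldType) (U V : lmodType K).

Definition tsum (W : lmodType K) (f : U -> V -> W) (s : seq (U * V)) : W :=
  \sum_(p <- s) f p.1 p.2.

Definition tequiv : rel (seq (U * V)) := fun s1 s2 =>
  `[< forall (W : lmodType K) (f : U -> V -> W),
      bilin f -> tsum f s1 = tsum f s2 >].

Lemma tequiv_is_equiv : equiv_class_of tequiv.
Proof.
split.
- by move=> s; apply/asboolP.
- by move=> s1 s2; apply/asboolP/asboolP => h W f fB; rewrite h.
- move=> s2 s1 s3 /asboolP h1 /asboolP h2; apply/asboolP => W f fB.
  by rewrite h1 // h2.
Qed.

Canonical tequiv_equiv := EquivRelPack tequiv_is_equiv.
Definition tensor : Type := {eq_quot tequiv}.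
HB.instance Definition _ := Choice.copy tensor {eq_quot tequiv}.

Definition tmk (s : seq (U * V)) : tensor := \pi_({eq_quot tequiv}) s.
Definition trepr (x : tensor) : seq (U * V) := repr (x : {eq_quot tequiv}).
Definition tens (u : U) (v : V) : tensor := tmk [:: (u, v)].
Definition tlift (W : lmodType K) (f : U -> V -> W) (x : tensor) : W :=
  tsum f (trepr x).

Lemma tmk_eqP s1 s2 :
  tmk s1 = tmk s2 <->
  (forall (W : lmodType K) (f : U -> V -> W), bilin f -> tsum f s1 = tsum f s2).
Proof.
split=> [/eqmodP/asboolP //|h]; apply/eqmodP; exact/asboolP.
Qed.

Lemma tmk_repr x : tmk (trepr x) = x. Proof. exact: reprK. Qed.

Lemma tlift_tmk (W : lmodType K) (f : U -> V -> W) s :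
  bilin f -> tlift f (tmk s) = tsum f s.
Proof. by move=> fB; have /tmk_eqP h := tmk_repr (tmk s); exact: h. Qed.

Lemma tsum_cat (W : lmodType K) (f : U -> V -> W) s1 s2 :
  tsum f (s1 ++ s2) = tsum f s1 + tsum f s2.
Proof. by rewrite /tsum big_cat. Qed.

Definition sscale (a : K) (s : seq (U * V)) := [seq (a *: p.1, p.2) | p <- s].

Lemma tsum_scale (W : lmodType K) (f : U -> V -> W) a s :
  bilin f -> tsum f (sscale a s) = a *: tsum f s.
Proof.
move=> fB; rewrite /tsum big_map scaler_sumr; apply: eq_bigr => p _ /=.
exact: bilinZl.
Qed.

Definition tzero : tensor := tmk [::].
Definition tadd (x y : tensor) : tensor := tmk (trepr x ++ trepr y).
Definition tscale a (x : tensor) : tensor := tmk (sscale a (trepr x)).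
Definition topp := tscale (-1).

Lemma tensP x y : (forall (W : lmodType K) (f : U -> V -> W), bilin f ->
  tlift f x = tlift f y) -> x = y.
Proof. by move=> h; rewrite -[x]tmk_repr -[y]tmk_repr; apply/tmk_eqP. Qed.

Section lift.
Variables (W : lmodType K) (f : U -> V -> W).
Hypothesis fB : bilin f.
Lemma tlift_add x y : tlift f (tadd x y) = tlift f x + tlift f y.
Proof. by rewrite tlift_tmk // tsum_cat. Qed.
Lemma tlift_scale a x : tlift f (tscale a x) = a *: tlift f x.
Proof. by rewrite tlift_tmk // tsum_scale. Qed.
Lemma tlift_zero : tlift f tzero = 0.
Proof. by rewrite tlift_tmk // /tsum big_nil. Qed.
End lift.

Fact taddA : associative tadd.
Proof. by move=> x y z; apply: tensP => W f fB; rewrite !tlift_add // addrA. Qed.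
Fact taddC : commutative tadd.
Proof. by move=> x y; apply: tensP => W f fB; rewrite !tlift_add // addrC. Qed.
Fact tadd0 : left_id tzero tadd.
Proof.
by move=> x; apply: tensP => W f fB; rewrite tlift_add // tlift_zero // add0r.
Qed.
Fact taddN : left_inverse tzero topp tadd.
Proof.
move=> x; apply: tensP => W f fB.
by rewrite tlift_add // tlift_scale // tlift_zero // scaleN1r addNr.
Qed.
HB.instance Definition _ := GRing.isZmodule.Build tensor taddA taddC tadd0 taddN.

Fact tscaleA a b x : tscale a (tscale b x) = tscale (a * b) x.
Proof. by apply: tensP => W f fB; rewrite !tlift_scale // scalerA. Qed.
Fact tscale1 : left_id 1 tscale.
Proof. by move=> x; apply: tensP => W f fB; rewrite !tlift_scale // scale1r. Qed.
Fact tscaleDr : right_distributive tscale +%R.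
Proof.
move=> a x y; apply: tensP => W f fB.
by rewrite tlift_scale // !tlift_add // !tlift_scale // scalerDr.
Qed.
Fact tscaleDl x : {morph tscale^~ x : a b / a + b}.
Proof.
move=> a b; apply: tensP => W f fB.
by rewrite !tlift_scale // tlift_add // !tlift_scale // scalerDl.
Qed.
HB.instance Definition _ :=
  GRing.Zmodule_isLmodule.Build K tensor tscaleA tscale1 tscaleDr tscaleDl.

Lemma tlift_linear (W : lmodType K) (f : U -> V -> W) :
  bilin f -> linear (tlift f).
Proof. by move=> fB a x y; rewrite tlift_add // tlift_scale. Qed.

Lemma tliftE (W : lmodType K) (f : U -> V -> W) u v :
  bilin f -> tlift f (tens u v) = f u v.
Proof. by move=> fB; rewrite tlift_tmk // /tsum big_seq1. Qed.

Lemma tens_bilin : bilin tens.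
Proof.
split=> [v a u u'|u a v v']; apply: tensP => W f fB; rewrite tlift_linear // !tliftE //.
  by rewrite fB.1.
by rewrite fB.2.
Qed.

Lemma tsum_tens x : x = \sum_(p <- trepr x) tens p.1 p.2.
Proof.
apply: tensP => W f fB.
have lin0 : tlift f 0 = 0 by exact: tlift_zero.
rewrite [LHS]/tlift /tsum; elim: (trepr x) => [|p s IH].
  by rewrite !big_nil lin0.
by rewrite !big_cons tlift_add // tliftE // IH.
Qed.

Lemma tens_ind (P : tensor -> Prop) :
  (forall u v, P (tens u v)) -> (forall x y, P x -> P y -> P (x + y)) ->
  forall x, P x.
Proof.
move=> Pt PD x; rewrite (tsum_tens x); elim: (trepr x) => [|p s IH].
  by rewrite big_nil -(bilin0l tens_bilin 0).
by rewrite big_cons; apply: PD.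
Qed.

Lemma tens_ext (W : lmodType K) (f g : tensor -> W) :
  linear f -> linear g -> (forall u v, f (tens u v) = g (tens u v)) -> f =1 g.
Proof.
move=> fL gL h; elim/tens_ind => // x y fx fy.
by rewrite -[x]scale1r fL gL fx fy.
Qed.
End Tensor.

Arguments tens {K U V} u v.
Notation "u ⊗ v" := (tens u v) (at level 40, left associativity) : ring_scope.

Section Tbilift.
Variables (K : fieldType) (U V U' V' W : lmodType K).
Variable m : U -> V -> U' -> V' -> W.
Definition tbilift (x : tensor U V) (y : tensor U' V') : W :=
  tlift (fun u v => tlift (m u v) y) x.
Hypothesis m12 : forall u' v', bilin (fun u v => m u v u' v').
Hypothesis m34 : forall u v, bilin (m u v).

Let inner_bilin y : bilin (fun u v => tlift (m u v) y).
Proof.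
split=> [v a u u'|u a v v'].
  elim/tens_ind: y => [w z|x y Hx Hy].
    by rewrite !tliftE // (m12 _ _).1.
  rewrite -[x]scale1r !tlift_linear // Hx Hy !scale1r scalerDr.
  by rewrite addrACA.
elim/tens_ind: y => [w z|x y Hx Hy].
  by rewrite !tliftE // (m12 _ _).2.
rewrite -[x]scale1r !tlift_linear // Hx Hy !scale1r scalerDr.
by rewrite addrACA.
Qed.

Lemma tbiliftE u v u' v' : tbilift (u ⊗ v) (u' ⊗ v') = m u v u' v'.
Proof. by rewrite /tbilift tliftE // tliftE. Qed.

Lemma tbilift_bilin : bilin tbilift.
Proof.
split=> [y|x]; first exact: tlift_linear.
move=> a y z; elim/tens_ind: x => [u v|x x' Hx Hx'].
  by rewrite /tbilift !tliftE // tlift_linear.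
rewrite /tbilift in Hx Hx' *.
rewrite -[x]scale1r !tlift_linear // Hx Hx' !scale1r scalerDr.
by rewrite addrACA.
Qed.
End Tbilift.

Lemma linear_functional (K : fieldType) (U : lmodType K) (u : U) :
  u != 0 -> exists2 f : U -> K^o, linear f & f u != 0.
Proof.
move=> u0.
pose P (S : set U) := (forall a x y, S x -> S y -> S (a *: x + y)) /\ ~ S u.
have [F FP Ftot|A [[Alin Au] Amax]] := @Zorn_bigcup U P.
  split=> [a x y [S FS Sx] [S' FS' S'y]|[S FS Su]]; last by case: (FP _ FS).
  have [SS'|S'S] := Ftot _ _ FS FS'.
    by exists S' => //; apply: (FP _ FS').1 => //; apply: SS'.
  by exists S => //; apply: (FP _ FS).1 => //; apply: S'S.
have A0 : A 0.
  have [[x Ax]|nA] := pselect (exists x, A x).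
    by rewrite -(addNr x) -scaleN1r; apply: Alin.
  have A_ x : ~ A x by move=> Ax; apply: nA; exists x.
  exfalso; apply: (Amax [set 0]%classic).
    split=> [x Ax|h]; first by have := A_ x.
    by apply: (A_ 0); apply: h.
  split=> [a x y /= -> ->|/= uE]; first by rewrite scaler0 addr0.
  by rewrite uE eqxx in u0.
have AZ a x : A x -> A (a *: x) by move=> Ax; rewrite -[_ *: _]addr0; apply: Alin.
have AD x y : A x -> A y -> A (x + y).
  by move=> Ax Ay; rewrite -[x]scale1r; apply: Alin.
have ex x : exists c : K, A (x - c *: u).
  have [Ax|nAx] := pselect (A x); first by exists 0; rewrite scale0r subr0.
  pose B : set U := [set z | exists y c, A y /\ z = y + c *: x]%classic.
  have AB : (A `<` B)%classic.
    split=> [z Az|h]; first by exists z, 0; rewrite scale0r addr0.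
    by apply: nAx; apply: h; exists 0, 1; rewrite scale1r add0r.
  have Blin a z z' : B z -> B z' -> B (a *: z + z').
    move=> [y [c [Ay ->]]] [y' [c' [Ay' ->]]].
    exists (a *: y + y'), (a * c + c'); split; first exact: Alin.
    by rewrite scalerDr scalerA addrACA -scalerDl.
  have : ~ ~ B u by move=> nB; apply: (Amax B AB); split.
  move=> /contrapT [y [c [Ay uE]]].
  have c0 : c != 0.
    apply/eqP => c0; apply: Au; by rewrite uE c0 scale0r addr0.
  exists c^-1; have -> : x - c^-1 *: u = - c^-1 *: y.
    by rewrite uE scalerDr scalerA mulVf // scale1r opprD addrCA subrr addr0 scaleNr.
  exact: AZ.
have uniq x c c' : A (x - c *: u) -> A (x - c' *: u) -> c = c'.
  move=> Ac Ac'; apply/eqP; rewrite -subr_eq0; apply/negPn/negP => n0; apply: Au.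
  have -> : u = (c - c')^-1 *: ((-1) *: (x - c *: u) + (x - c' *: u)).
    rewrite scaleN1r opprB addrA subrK -scalerBl.
    by rewrite scalerA mulVf // scale1r.
  by apply/AZ/Alin.
pose f x : K^o := sval (cid (ex x)).
have fP x : A (x - f x *: u) := svalP (cid (ex x)).
exists f.
  move=> a x y; apply: (uniq (a *: x + y)); first exact: fP.
  have -> : a *: x + y - (a *: f x + f y) *: u = a *: (x - f x *: u) + (y - f y *: u).
    by rewrite scalerDl scalerBr opprD addrACA -scalerA.
  exact: Alin.
apply/eqP => fu; apply: Au; have := fP u; by rewrite fu scale0r subr0.
Qed.

Lemma tens_neq0 (K : fieldType) (U V : lmodType K) (u : U) (v : V) :
  u != 0 -> v != 0 -> u ⊗ v != 0.
Proof.
move=> /linear_functional [f fL fu] v0.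
have gB : bilin (fun x y => f x *: y : V).
  split=> [y a x x'|x a y y'] /=; first by rewrite fL scalerDl -scalerA.
  by rewrite scalerDr !scalerA mulrC.
apply/eqP => uv0; have := tliftE u v gB; rewrite uv0.
have -> : tlift (fun x y => f x *: y) (0 : tensor U V) = 0 :> V.
  have := tlift_linear gB (-1) 0 0.
  by rewrite !scaleN1r !addNr.
by move/esym/eqP; rewrite scaler_eq0 (negPf fu) (negPf v0).
Qed.

Lemma linear_mulr (K : fieldType) (A : algType K) (x : A) : linear (fun y => x * y).
Proof. by move=> a y z; rewrite mulrDr scalerAr. Qed.
Lemma linear_mull (K : fieldType) (A : algType K) (x : A) : linear (fun y => y * x).
Proof. by move=> a y z; rewrite mulrDl scalerAl. Qed.

Section AlgTensor.
Variables (K : fieldType) (A B : algType K).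

Definition tmul : tensor A B -> tensor A B -> tensor A B :=
  tbilift (fun a b a' b' => (a * a') ⊗ (b * b')).

Let m12 (a' : A) (b' : B) : bilin (fun a b => (a * a') ⊗ (b * b') : tensor A B).
Proof.
split=> [b c a1 a2|a c b1 b2] /=; rewrite mulrDl -scalerAl.
  exact: (tens_bilin _ _).1.
exact: (tens_bilin _ _).2.
Qed.

Let m34 (a : A) (b : B) : bilin (fun a' b' => (a * a') ⊗ (b * b') : tensor A B).
Proof.
split=> [b' c a1 a2|a' c b1 b2] /=; rewrite mulrDr -scalerAr.
  exact: (tens_bilin _ _).1.
exact: (tens_bilin _ _).2.
Qed.

Lemma tmulE a b a' b' : tmul (a ⊗ b) (a' ⊗ b') = (a * a') ⊗ (b * b').
Proof. exact: tbiliftE. Qed.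

Let mB : bilin tmul. Proof. exact: tbilift_bilin. Qed.

Fact tmulA : associative tmul.
Proof.
move=> x y z; elim/tens_ind: x => [a b|x x' hx hx']; last first.
  by rewrite !(bilinDl mB) hx hx'.
elim/tens_ind: y => [a' b'|x x' hx hx']; last first.
  by rewrite !(bilinDl mB, bilinDr mB) hx hx'.
elim/tens_ind: z => [a'' b''|x x' hx hx']; last first.
  by rewrite !(bilinDr mB) hx hx'.
by rewrite !tmulE !mulrA.
Qed.

Fact tmul1l : left_id (1 ⊗ 1) tmul.
Proof.
move=> x; elim/tens_ind: x => [a b|x x' hx hx']; last by rewrite (bilinDr mB) hx hx'.
by rewrite tmulE !mul1r.
Qed.

Fact tmul1r : right_id (1 ⊗ 1) tmul.
Proof.
move=> x; elim/tens_ind: x => [a b|x x' hx hx']; last by rewrite (bilinDl mB) hx hx'.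
by rewrite tmulE !mulr1.
Qed.

Fact tmulDl : left_distributive tmul +%R.
Proof. by move=> x y z; rewrite (bilinDl mB). Qed.
Fact tmulDr : right_distributive tmul +%R.
Proof. by move=> x y z; rewrite (bilinDr mB). Qed.
Fact tone_neq0 : (1 : A) ⊗ (1 : B) != 0.
Proof. by rewrite tens_neq0 ?oner_neq0. Qed.

HB.instance Definition _ := GRing.Zmodule_isNzRing.Build (tensor A B)
  tmulA tmul1l tmul1r tmulDl tmulDr tone_neq0.
Fact tmulZl a (x y : tensor A B) : a *: (x * y) = (a *: x) * y.
Proof. exact: esym (bilinZl mB a x y). Qed.
Fact tmulZr a (x y : tensor A B) : a *: (x * y) = x * (a *: y).
Proof. exact: esym (bilinZr mB a x y). Qed.
HB.instance Definition _ := GRing.Lmodule_isLalgebra.Build K (tensor A B) tmulZl.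
HB.instance Definition _ := GRing.Lalgebra_isAlgebra.Build K (tensor A B) tmulZr.
End AlgTensor.

(* A differential N-graded algebra: [dcomp k x] is the component of degree k
   of x, so the subspace of degree k is [homog k] and the last conditions on
   [dcomp] say that the algebra is the direct sum of these subspaces. *)
Record dga (K : fieldType) := Dga {
  dga_alg :> algType K;
  dcomp : nat -> {linear dga_alg -> dga_alg};
  dd : {linear dga_alg -> dga_alg};
  dcomp_proj : forall k l x,
    dcomp k (dcomp l x) = if k == l then dcomp l x else 0;
  dcomp_sum : forall x, exists n, x = \sum_(k < n) dcomp k x;
  homog1 : dcomp 0 1 = 1;
  homogM : forall k l x y, dcomp k x = x -> dcomp l y = y ->
    dcomp (k + l) (x * y) = x * y;
  homogd : forall k x, dcomp k x = x -> dcomp k.+1 (dd x) = dd x;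
  ddK : forall x, dd (dd x) = 0;
  ddM : forall k x y, dcomp k x = x ->
    dd (x * y) = dd x * y + (-1) ^+ k *: (x * dd y)
}.

Arguments dcomp {K d}.
Arguments dd {K d}.

Definition homog (K : fieldType) (Om : dga K) (k : nat) (x : Om) : Prop :=
  dcomp k x = x.

Section GradedSum.
Variables (K : fieldType) (Om : dga K).
Implicit Types (x y : Om).

Lemma homog_comp k x : homog k (dcomp k x).
Proof. by rewrite /homog dcomp_proj eqxx. Qed.

Lemma homog_compE k l x : homog l x -> dcomp k x = if k == l then x else 0.
Proof. by move=> hx; rewrite -{1}hx dcomp_proj hx. Qed.

Lemma dcomp_bounded x : exists n, forall k, (n <= k)%N -> dcomp k x = 0.
Proof.
have [n xE] := dcomp_sum x; exists n => k nk.
rewrite xE linear_sum big1 // => i _; rewrite dcomp_proj.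
by case: eqP => // ki; have := ltn_ord i; rewrite -ki ltnNge nk.
Qed.

Definition dbound x : nat := sval (cid (dcomp_bounded x)).

(* The sum of F k (x_k) over all the homogeneous components x_k of x. *)
Definition gsum (W : lmodType K) (F : nat -> Om -> W) x : W :=
  \sum_(k < dbound x) F k (dcomp k x).

Lemma homog_ind (P : Om -> Prop) :
  (forall k x, homog k x -> P x) -> (forall x y, P x -> P y -> P (x + y)) ->
  forall x, P x.
Proof.
move=> Ph PD x; have [n ->] := dcomp_sum x.
elim: n => [|n IH]; last first.
  by rewrite big_ord_recr /=; apply: PD => //; apply: (Ph n); exact: homog_comp.
by rewrite big_ord0; apply: (Ph 0%N); rewrite /homog linear0.
Qed.

Section Lin.
Variables (W : lmodType K) (F : nat -> Om -> W).
Hypothesis FL : forall k, linear (F k).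

Let F0 k : F k 0 = 0.
Proof. by have := FL k (-1) 0 0; rewrite !scaleN1r !addNr. Qed.

Lemma gsumE n x : (forall k, (n <= k)%N -> dcomp k x = 0) ->
  gsum F x = \sum_(k < n) F k (dcomp k x).
Proof.
have gen m m' : (m <= m')%N -> (forall k, (m <= k)%N -> dcomp k x = 0) ->
    \sum_(k < m) F k (dcomp k x) = \sum_(k < m') F k (dcomp k x).
  move=> mm' hm; rewrite -(subnKC mm') big_split_ord /= [X in _ + X]big1 ?addr0 //.
  by move=> i _; rewrite hm ?F0 ?leq_addr.
move=> hn; rewrite /gsum.
have hb : forall k, (dbound x <= k)%N -> dcomp k x = 0 := svalP (cid (dcomp_bounded x)).
have [le|/ltnW le] := leqP (dbound x) n; first exact: gen.
by symmetry; apply: gen.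
Qed.

Lemma gsum_linear : linear (gsum F).
Proof.
move=> a x y.
have [n hx] := dcomp_bounded x; have [m hy] := dcomp_bounded y.
rewrite (@gsumE (maxn n m) x) => [|k]; last by rewrite geq_max => /andP[/hx].
rewrite (@gsumE (maxn n m) y) => [|k]; last by rewrite geq_max => /andP[_ /hy].
rewrite (@gsumE (maxn n m)) => [|k]; last first.
  by rewrite geq_max => /andP[/hx hk /hy hk']; rewrite linearP hk hk' scaler0 addr0.
rewrite scaler_sumr -big_split; apply: eq_bigr => i _ /=.
by rewrite linearP FL.
Qed.

Lemma gsum_homog k x : homog k x -> gsum F x = F k x.
Proof.
move=> hx; rewrite (@gsumE k.+1) => [|l kl]; last first.
  by rewrite (homog_compE _ hx); case: eqP => // lk; rewrite lk ltnn in kl.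
rewrite big_ord_recr /= hx big1 ?add0r // => i _.
rewrite (homog_compE _ hx); case: eqP => [ik|_]; last exact: F0.
by have := ltn_ord i; rewrite ik ltnn.
Qed.
End Lin.

Lemma gsum_param (V W : lmodType K) (F : V -> nat -> Om -> W) x :
  (forall k y, linear (fun v => F v k y)) -> linear (fun v => gsum (F v) x).
Proof.
move=> FL a v w; rewrite /gsum scaler_sumr -big_split.
by apply: eq_bigr => i _; exact: FL.
Qed.
End GradedSum.

Lemma tensZDl (K : fieldType) (U V : lmodType K) (f : U -> U) (c : K) v :
  linear f -> linear (fun u => c *: (f u ⊗ v) : tensor U V).
Proof.
move=> fL a u u'; rewrite fL (tens_bilin _ _).1 scalerDr.
by rewrite !scalerA mulrC.
Qed.

Lemma tensZDr (K : fieldType) (U V : lmodType K) (f : V -> V) (c : K) u :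
  linear f -> linear (fun v => c *: (u ⊗ f v) : tensor U V).
Proof.
move=> fL a v v'; rewrite fL (tens_bilin _ _).2 scalerDr.
by rewrite !scalerA mulrC.
Qed.

Lemma id_linear (K : fieldType) (U : lmodType K) : linear (fun u : U => u).
Proof. by []. Qed.

Section DgaTensor.
Variables (K : fieldType) (Om Om' : dga K).

(* A copy of [tensor Om Om'], whose own product is the one without signs. *)
Definition gtensor : Type := tensor Om Om'.
HB.instance Definition _ := GRing.Lmodule.copy gtensor (tensor Om Om').

(* (w (x) n) (w' (x) n') = (-1)^(|n||w'|) w w' (x) n n'; see [gmulE]. *)
Definition gmul4 (w : Om) (n : Om') (w' : Om) (n' : Om') : gtensor :=
  gsum (fun i ni =>
    gsum (fun j wj => (-1) ^+ (i * j) *: ((w * wj) ⊗ (ni * n'))) w') n.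
Definition gmul : gtensor -> gtensor -> gtensor := tbilift gmul4.

(* d(w (x) n) = dw (x) n + (-1)^|w| w (x) dn; see [gdE]. *)
Definition gd2 (w : Om) (n : Om') : gtensor :=
  dd w ⊗ n + gsum (fun i wi => (-1) ^+ i *: (wi ⊗ dd n)) w.
Definition gd : gtensor -> gtensor := tlift gd2.

Definition gcomp2 k (w : Om) (n : Om') : gtensor :=
  \sum_(i < k.+1) (dcomp i w ⊗ dcomp (k - i) n).
Definition gcomp k : gtensor -> gtensor := tlift (gcomp2 k).

Let mwL c (w : Om) (n : Om') : linear (fun wj => c *: ((w * wj) ⊗ n) : gtensor).
Proof. by apply: tensZDl; exact: linear_mulr. Qed.

Let in_linear w w' n' i :
  linear (fun ni => gsum (fun j wj => (-1) ^+ (i * j) *: ((w * wj) ⊗ (ni * n'))) w'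
            : gtensor).
Proof. by apply: gsum_param => j y; apply: tensZDr; exact: linear_mull. Qed.

Let m12 w' n' : bilin (fun w n => gmul4 w n w' n').
Proof.
split=> [n|w]; last by apply: gsum_linear => i; exact: in_linear.
apply: gsum_param => i ni; apply: gsum_param => j wj.
by apply: tensZDl; exact: linear_mull.
Qed.

Let m34 w n : bilin (gmul4 w n).
Proof.
split=> [n'|w'].
  by apply: gsum_param => i ni; apply: gsum_linear => j; exact: mwL.
apply: gsum_param => i ni; apply: gsum_param => j wj.
by apply: tensZDr; exact: linear_mulr.
Qed.

Let mB : bilin gmul. Proof. exact: tbilift_bilin. Qed.

Lemma gmulE w n w' n' i j : homog i n -> homog j w' ->
  gmul (w ⊗ n) (w' ⊗ n') = (-1) ^+ (i * j) *: ((w * w') ⊗ (n * n')).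
Proof.
move=> hn hw; rewrite /gmul tbiliftE // /gmul4 (gsum_homog _ hn) //.
by rewrite (gsum_homog _ hw).
Qed.

Lemma gd2_bilin : bilin gd2.
Proof.
split=> [n a w w'|w a n n'] /=; rewrite /gd2.
  rewrite linearP (tens_bilin _ _).1 gsum_linear; last first.
    by move=> k; apply: (@tensZDl _ _ _ (fun x => x)); exact: id_linear.
  by rewrite scalerDr addrACA.
have gL : linear (fun n => gsum (fun i wi => (-1) ^+ i *: (wi ⊗ dd n)) w : gtensor).
  by apply: gsum_param => k y; apply: tensZDr; exact: linearP.
by rewrite (tens_bilin _ _).2 gL scalerDr addrACA.
Qed.

Lemma gdE w n i : homog i w ->
  gd (w ⊗ n) = (dd w ⊗ n : gtensor) + (-1) ^+ i *: (w ⊗ dd n).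
Proof.
move=> hw; rewrite /gd tliftE; last exact: gd2_bilin.
rewrite /gd2 (gsum_homog _ hw) // => k.
by apply: (@tensZDl _ _ _ (fun x => x)); exact: id_linear.
Qed.

Lemma gcomp2_bilin k : bilin (gcomp2 k).
Proof.
split=> [n a w w'|w a n n'] /=; rewrite /gcomp2 scaler_sumr -big_split;
  apply: eq_bigr => i _ /=.
  by rewrite linearP (tens_bilin _ _).1.
by rewrite linearP (tens_bilin _ _).2.
Qed.

Lemma gcompE k w n i j : homog i w -> homog j n ->
  gcomp k (w ⊗ n) = if k == (i + j)%N then w ⊗ n else 0.
Proof.
move=> hw hn; rewrite /gcomp tliftE; last exact: gcomp2_bilin.
rewrite /gcomp2; case: eqP => [->|kij].
  have ilt : (i < (i + j).+1)%N by rewrite ltnS leq_addr.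
  rewrite (bigD1 (Ordinal ilt)) //= addKn hw hn big1 ?addr0 // => l li.
  rewrite (homog_compE _ hw); case: eqP => [lE|_].
    by case/eqP: li; apply: val_inj.
  exact: (bilin0l (tens_bilin _ _)).
rewrite big1 // => l _; rewrite (homog_compE _ hw); case: eqP => [lE|_]; last first.
  exact: (bilin0l (tens_bilin _ _)).
rewrite (homog_compE _ hn); case: eqP => [kE|_]; last first.
  exact: (bilin0r (tens_bilin _ _)).
by case: kij; rewrite -kE lE subnKC // -lE -ltnS.
Qed.

Lemma gtensor_ind (P : gtensor -> Prop) :
  (forall i j w n, homog i w -> homog j n -> P (w ⊗ n)) ->
  (forall x y, P x -> P y -> P (x + y)) -> forall x, P x.
Proof.
move=> Ph PD; apply: tens_ind => // w n.
elim/homog_ind: w => [i w hw|w w' hw hw']; last first.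
  by rewrite (bilinDl (tens_bilin _ _)); exact: PD.
elim/homog_ind: n => [j n hn|n n' hn hn']; last first.
  by rewrite (bilinDr (tens_bilin _ _)); exact: PD.
exact: (Ph i j).
Qed.

Let hM (O : dga K) k l (x y : O) : homog k x -> homog l y -> homog (k + l) (x * y).
Proof. exact: homogM. Qed.
Let h1 (O : dga K) : homog 0 (1 : O). Proof. exact: homog1. Qed.

Fact gmulA : associative gmul.
Proof.
move=> x y z; elim/gtensor_ind: x => [i j a b ha hb|x x' hx hx']; last first.
  by rewrite !(bilinDl mB) hx hx'.
elim/gtensor_ind: y => [i' j' a' b' ha' hb'|x x' hx hx']; last first.
  by rewrite !(bilinDl mB, bilinDr mB) hx hx'.
elim/gtensor_ind: z => [i'' j'' a'' b'' ha'' hb''|x x' hx hx']; last first.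
  by rewrite !(bilinDr mB) hx hx'.
rewrite (gmulE _ _ hb' ha'') (gmulE _ _ hb ha') (bilinZl mB) (bilinZr mB).
rewrite (gmulE _ _ hb (hM ha' ha'')) (gmulE _ _ (hM hb hb') ha'').
rewrite !scalerA -!exprD !mulrA; congr (_ ^+ _ *: _).
by rewrite mulnDl mulnDr [LHS]addnC addnA.
Qed.

Fact gmul1l : left_id (1 ⊗ 1 : gtensor) gmul.
Proof.
move=> x; elim/gtensor_ind: x => [i j a b ha hb|x x' hx hx'].
  by rewrite (gmulE _ _ (h1 _) ha) mul0n scale1r !mul1r.
by rewrite (bilinDr mB) hx hx'.
Qed.

Fact gmul1r : right_id (1 ⊗ 1 : gtensor) gmul.
Proof.
move=> x; elim/gtensor_ind: x => [i j a b ha hb|x x' hx hx'].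
  by rewrite (gmulE _ _ hb (h1 _)) muln0 scale1r !mulr1.
by rewrite (bilinDl mB) hx hx'.
Qed.

Fact gmulDl : left_distributive gmul +%R.
Proof. by move=> x y z; rewrite (bilinDl mB). Qed.
Fact gmulDr : right_distributive gmul +%R.
Proof. by move=> x y z; rewrite (bilinDr mB). Qed.
Fact gone_neq0 : (1 : Om) ⊗ (1 : Om') != 0 :> gtensor.
Proof. exact: (tens_neq0 (oner_neq0 _) (oner_neq0 _)). Qed.

HB.instance Definition _ := GRing.Zmodule_isNzRing.Build gtensor
  gmulA gmul1l gmul1r gmulDl gmulDr gone_neq0.
Fact gmulZl a (x y : gtensor) : a *: gmul x y = gmul (a *: x) y.
Proof. exact: esym (bilinZl mB a x y). Qed.
Fact gmulZr a (x y : gtensor) : a *: gmul x y = gmul x (a *: y).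
Proof. exact: esym (bilinZr mB a x y). Qed.
HB.instance Definition _ := GRing.Lmodule_isLalgebra.Build K gtensor gmulZl.
HB.instance Definition _ := GRing.Lalgebra_isAlgebra.Build K gtensor gmulZr.

Fact gd_linear : linear gd.
Proof. exact: (tlift_linear gd2_bilin). Qed.
HB.instance Definition _ := GRing.isLinear.Build K gtensor gtensor _ gd gd_linear.
Fact gcomp_linear k : linear (gcomp k).
Proof. exact: (tlift_linear (gcomp2_bilin k)). Qed.
HB.instance Definition _ k :=
  GRing.isLinear.Build K gtensor gtensor _ (gcomp k) (gcomp_linear k).

Lemma gmulrE w n w' n' i j : homog i n -> homog j w' ->
  (w ⊗ n : gtensor) * (w' ⊗ n' : gtensor)
    = (-1) ^+ (i * j) *: ((w * w') ⊗ (n * n')).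
Proof. exact: gmulE. Qed.

Fact gcomp_proj k l x : gcomp k (gcomp l x) = if k == l then gcomp l x else 0.
Proof.
elim/gtensor_ind: x => [i j a b ha hb|x x' hx hx']; last first.
  by rewrite !linearD /= hx hx'; case: ifP => // _; rewrite addr0.
rewrite (gcompE l ha hb); case: (l =P _) => [->|lij].
  by rewrite (gcompE _ ha hb).
by rewrite linear0 if_same.
Qed.

Fact gcomp_sum x : exists n, x = \sum_(k < n) gcomp k x.
Proof.
have ext y n m : y = \sum_(k < n) gcomp k y -> (n <= m)%N ->
    y = \sum_(k < m) gcomp k y.
  move=> yE nm; rewrite -(subnKC nm) big_split_ord /= -yE big1 ?addr0 // => i _.
  rewrite yE linear_sum big1 // => k _ /=; rewrite gcomp_proj.
  by case: eqP => // /eqP; rewrite gtn_eqF // (leq_trans (ltn_ord k)) // leq_addr.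
elim/gtensor_ind: x => [i j a b ha hb|x y [n hx] [m hy]].
  exists (i + j).+1; rewrite big_ord_recr /= (gcompE _ ha hb) eqxx big1 ?add0r //.
  by move=> k _; rewrite (gcompE _ ha hb) ltn_eqF.
exists (maxn n m).
rewrite {1}(ext _ _ _ hx (leq_maxl n m)) {1}(ext _ _ _ hy (leq_maxr n m)).
by rewrite -big_split; apply: eq_bigr => k _ /=; rewrite linearD.
Qed.

Fact ghomog1 : gcomp 0 1 = 1.
Proof. by rewrite [LHS](gcompE 0 (h1 _) (h1 _)). Qed.

Fact ghomogM k l (x y : gtensor) : gcomp k x = x -> gcomp l y = y ->
  gcomp (k + l) (x * y) = x * y.
Proof.
move=> <- <-.
elim/gtensor_ind: x => [i j a b ha hb|x x' hx hx']; last first.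
  by rewrite linearD /= mulrDl linearD /= hx hx'.
elim/gtensor_ind: y => [i' j' a' b' ha' hb'|x x' hx hx']; last first.
  by rewrite linearD /= mulrDr linearD /= hx hx'.
rewrite (gcompE _ ha hb) (gcompE _ ha' hb').
case: eqP => [->|_]; last by rewrite mul0r linear0.
case: eqP => [->|_]; last by rewrite mulr0 linear0.
rewrite (gmulrE _ _ hb ha') linearZ /= (gcompE _ (hM ha ha') (hM hb hb')).
by rewrite addnACA eqxx.
Qed.

Fact ghomogd k (x : gtensor) : gcomp k x = x -> gcomp k.+1 (gd x) = gd x.
Proof.
move=> <-; elim/gtensor_ind: x => [i j a b ha hb|x x' hx hx']; last first.
  by rewrite !linearD /= hx hx'.
rewrite (gcompE _ ha hb); case: eqP => [->|_]; last by rewrite !linear0.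
rewrite (gdE _ ha) linearD linearZ /=.
rewrite (gcompE _ (homogd ha) hb) (gcompE _ ha (homogd hb)).
by rewrite addSn addnS eqxx.
Qed.

Fact gddK (x : gtensor) : gd (gd x) = 0.
Proof.
elim/gtensor_ind: x => [i j a b ha hb|x x' hx hx']; last first.
  by rewrite !linearD /= hx hx' addr0.
rewrite (gdE _ ha) linearD linearZ /= (gdE _ (homogd ha)) (gdE _ ha) !ddK.
rewrite (bilin0l (tens_bilin _ _)) (bilin0r (tens_bilin _ _)) scaler0 addr0 add0r.
by rewrite exprS mulN1r scaleNr addNr.
Qed.

Fact gddM k (x y : gtensor) : gcomp k x = x ->
  gd (x * y) = gd x * y + (-1) ^+ k *: (x * gd y).
Proof.
move=> <-; elim/gtensor_ind: x => [i j a b ha hb|x x' hx hx']; last first.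
  by rewrite !linearD /= mulrDl linearD /= hx hx' addrACA mulrDl mulrDl scalerDr.
elim/gtensor_ind: y => [i' j' a' b' ha' hb'|x x' hx hx']; last first.
  rewrite !linearD /= mulrDr linearD /= hx hx' addrACA !mulrDr -scalerDr.
  by rewrite -!mulrDr.
rewrite (gcompE _ ha hb).
case: eqP => [->|_]; last by rewrite !(mul0r, linear0) addr0.
rewrite (gmulrE _ _ hb ha') linearZ /= (gdE _ (hM ha ha')) (gdE _ ha) (gdE _ ha').
rewrite mulrDl mulrDr -scalerAl -scalerAr.
rewrite (gmulrE _ _ hb ha') (gmulrE _ _ (homogd hb) ha') (gmulrE _ _ hb ha').
rewrite (gmulrE _ _ hb (homogd ha')) (ddM _ ha) (ddM _ hb).
rewrite (bilinDl (tens_bilin _ _)) (bilinDr (tens_bilin _ _)).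
rewrite (bilinZl (tens_bilin _ _)) (bilinZr (tens_bilin _ _)) !scalerDr !scalerA.
rewrite -!exprD -!addrA; congr (_ + _).
have sgn2 m n : odd m = odd n -> (-1) ^+ m = (-1) ^+ n :> K.
  by move=> mn; rewrite -[LHS]signr_odd mn signr_odd.
rewrite [LHS]addrCA; congr (_ *: _ + (_ *: _ + _ *: _)); apply: sgn2;
  rewrite !(oddS, oddD, oddM);
  by case: (odd i); case: (odd j); case: (odd i').
Qed.

Definition dga_tensor : dga K :=
  @Dga K gtensor (fun k => gcomp k) gd gcomp_proj gcomp_sum ghomog1 ghomogM
    ghomogd gddK gddM.
End DgaTensor.


Definition tmap (K : fieldType) (U V U' V' : lmodType K)
    (f : U -> U') (g : V -> V') : tensor U V -> tensor U' V' :=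
  tlift (fun u v => f u ⊗ g v).

Definition tassoc (K : fieldType) (U V W : lmodType K) :
    tensor (tensor U V) W -> tensor U (tensor V W) :=
  tlift (fun x w => tlift (fun u v => u ⊗ (v ⊗ w)) x).

Record hopf_algebra (K : fieldType) := HopfAlgebra {
  hopf_alg :> algType K;
  comul : {lrmorphism hopf_alg -> tensor hopf_alg hopf_alg};
  counit : {lrmorphism hopf_alg -> K^o};
  antipode : {linear hopf_alg -> hopf_alg};
  comulA : forall h, tassoc (tmap comul idfun (comul h)) =
                     tmap idfun comul (comul h);
  counitl : forall h, tlift (fun x y => (counit x : K) *: y) (comul h) = h;
  counitr : forall h, tlift (fun x y => (counit y : K) *: x) (comul h) = h;
  antipodel : forall h,
    tlift (fun x y => antipode x * y) (comul h) = (counit h : K) *: 1;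
  antipoder : forall h,
    tlift (fun x y => x * antipode y) (comul h) = (counit h : K) *: 1
}.

Arguments comul {K _}.
Arguments counit {K _}.
Arguments antipode {K _}.

Record comodule_algebra (K : fieldType) (H : hopf_algebra K) := ComoduleAlgebra {
  comod_alg :> algType K;
  coact : {lrmorphism comod_alg -> tensor comod_alg H};
  coactA : forall a, tassoc (tmap coact idfun (coact a)) =
                     tmap idfun comul (coact a);
  coact_counit : forall a, tlift (fun x h => (counit h : K) *: x) (coact a) = a
}.

Arguments coact {K H _}.

(* [cemb] identifies A with the degree 0 part of the calculus. *)
Record calculus (K : fieldType) (A : algType K) := Calculus {
  calc_dga :> dga K;
  cemb : {lrmorphism A -> calc_dga};
  cemb_inj : injective cemb;
  cemb_deg0 : forall w : calc_dga, homog 0 w <-> exists a, w = cemb a;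
  calc_span : forall k (w : calc_dga), homog k w ->
    exists s : seq (A * k.-tuple A),
      w = \sum_(p <- s) cemb p.1 * \prod_(b <- p.2) dd (cemb b)
}.

Arguments cemb {K A} _.

Definition dga_morphism (K : fieldType) (Om Om' : dga K)
    (f : {lrmorphism Om -> Om'}) : Prop :=
  (forall k w, homog k w -> homog k (f w)) /\ (forall w, f (dd w) = dd (f w)).

Definition complete_calculus (K : fieldType) (H : hopf_algebra K)
    (A : comodule_algebra H) (OmH : calculus H) (OmA : calculus A) : Prop :=
  exists2 f : {lrmorphism OmA -> dga_tensor OmA OmH},
    dga_morphism f &
    forall a, f (cemb OmA a) = tmap (cemb OmA) (cemb OmH) (coact a).

Definition generates (K : fieldType) (A : algType K) (s : seq A) : Prop :=
  forall S : A -> Prop, S 1 ->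
    (forall (c : K) x y, S x -> S y -> S (c *: x + y)) ->
    (forall x y, S x -> S y -> S (x * y)) ->
    (forall x, x \in s -> S x) -> forall x, S x.

(* e is a basis of the part of degree k of Om as a left A-module. *)
Definition left_basis (K : fieldType) (A : algType K) (Om : calculus A)
    (k : nat) (e : seq Om) : Prop :=
  (forall i : 'I_(size e), homog k e`_i) /\
  forall w : Om, homog k w ->
    exists! c : (size e).-tuple A,
      w = \sum_(i < size e) cemb Om (tnth c i) * e`_i.

(* H = K[t, tV] with tV = t^-1, presented by generators and relations. *)
Record is_OU1 (K : fieldType) (H : hopf_algebra K) (t tV : H) : Prop := IsOU1 {
  OU1_mulV : t * tV = 1;
  OU1_mulVl : tV * t = 1;
  OU1_gen : generates [:: t; tV];
  OU1_univ : forall (B : algType K) (b b' : B), b * b' = 1 -> b' * b = 1 ->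
    exists2 f : {lrmorphism H -> B}, f t = b & f tV = b';
  OU1_comul : comul t = t ⊗ t;
  OU1_counit : counit t = 1;
  OU1_antipode : antipode t = tV
}.

Record is_OU1_calculus (K : fieldType) (q : K) (H : hopf_algebra K) (t : H)
    (Om : calculus H) : Prop := IsOU1Calculus {
  OU1_basis1 : left_basis 1 [:: dd (cemb Om t)];
  OU1_dt : dd (cemb Om t) * cemb Om t = q ^+ 2 *: (cemb Om t * dd (cemb Om t));
  OU1_deg2 : forall k (w : Om), (2 <= k)%N -> homog k w -> w = 0
}.

(* Here and below a, b, c, d stand for alpha, beta, gamma, delta. *)
Record SUq2_rel (K : fieldType) (q : K) (B : algType K) (a b c d : B) : Prop :=
  SUq2Rel {
  SUq2_ba : b * a = q *: (a * b);
  SUq2_ca : c * a = q *: (a * c);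
  SUq2_db : d * b = q *: (b * d);
  SUq2_dc : d * c = q *: (c * d);
  SUq2_cb : c * b = b * c;
  SUq2_da : d * a - a * d = (q - q^-1) *: (b * c);
  SUq2_det : a * d - q^-1 *: (b * c) = 1
}.

Record is_OqSU2 (K : fieldType) (q : K) (H : hopf_algebra K) (t tV : H)
    (A : comodule_algebra H) (a b c d : A) : Prop := IsOqSU2 {
  OqSU2_rel : SUq2_rel q a b c d;
  OqSU2_gen : generates [:: a; b; c; d];
  OqSU2_univ : forall (B : algType K) (a' b' c' d' : B),
    SUq2_rel q a' b' c' d' ->
    exists f : {lrmorphism A -> B}, [/\ f a = a', f b = b', f c = c' & f d = d'];
  OqSU2_coact_a : coact a = a ⊗ t;
  OqSU2_coact_b : coact b = b ⊗ tV;
  OqSU2_coact_c : coact c = c ⊗ t;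
  OqSU2_coact_d : coact d = d ⊗ tV
}.

Section CalculusSU2.
Variables (K : fieldType) (q : K) (A : algType K) (Om : calculus A).
Variables a b c d : A.
Local Notation ι := (cemb Om).

Definition eplus : Om := q^-1 *: (ι a * dd (ι c)) - q ^- 2 *: (ι c * dd (ι a)).
Definition eminus : Om := ι d * dd (ι b) - q *: (ι b * dd (ι d)).
Definition ezero : Om := ι d * dd (ι a) - q *: (ι b * dd (ι c)).

(* The pairs (f, |f|), where the coaction maps f to f (x) t^|f|. *)
Definition gen_degrees : seq (A * int) :=
  [:: (a, 1); (b, -1); (c, 1); (d, -1)].

Local Notation ep := eplus.
Local Notation em := eminus.
Local Notation e0 := ezero.

(* The factor 1 + q^-2 is the quantum integer [2] for the parameter q^-2. *)
Record is_SUq2_calculus : Prop := IsSUq2Calculus {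
  SUq2_basis1 : left_basis 1 [:: ep; em; e0];
  SUq2_ep_comm : forall f n, (f, n) \in gen_degrees ->
    ep * ι f = q ^ n *: (ι f * ep);
  SUq2_em_comm : forall f n, (f, n) \in gen_degrees ->
    em * ι f = q ^ n *: (ι f * em);
  SUq2_e0_comm : forall f n, (f, n) \in gen_degrees ->
    e0 * ι f = q ^ (2 * n) *: (ι f * e0);
  SUq2_basis2 : left_basis 2 [:: ep * em; ep * e0; em * e0];
  SUq2_epem : ep * em = - q ^- 2 *: (em * ep);
  SUq2_epe0 : ep * e0 = - q ^- 4 *: (e0 * ep);
  SUq2_eme0 : em * e0 = - q ^+ 4 *: (e0 * em);
  SUq2_epep : ep * ep = 0;
  SUq2_emem : em * em = 0;
  SUq2_e0e0 : e0 * e0 = 0;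
  SUq2_de0 : dd e0 = q ^+ 3 *: (ep * em);
  SUq2_dep : dd ep = - (q ^+ 2 * (1 + q ^- 2)) *: (ep * e0);
  SUq2_dem : dd em = (q ^- 2 * (1 + q ^- 2)) *: (em * e0);
  SUq2_basis3 : left_basis 3 [:: ep * em * e0];
  SUq2_deg4 : forall k (w : Om), (3 < k)%N -> homog k w -> w = 0
}.
End CalculusSU2.

(* Main.v *)
From HB Require Import structures.
Require Import Defs.
From mathcomp Require Import all_boot all_order all_algebra reals.
From mathcomp Require Import boolp.

Set Implicit Arguments.
Unset Strict Implicit.
Unset Printing Implicit Defensive.
Import GRing.Theory.
Local Open Scope ring_scope.

(** Write A for the quantum SU(2) algebra, Om for its calculus, G for the graded
    tensor product of Om with the calculus of H, and phi : A -> G for the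
    coaction followed by the inclusion of degree 0, an algebra map.  An
    extension of the coaction must send x dy to phi(x) d(phi y), so everything
    is decided by whether this prescription is well defined.

    In Om every form is a unique left A-combination of the eight monomials
    1, e+, e-, e0, e+e-, e+e0, e-e0, e+e-e0, and the products of such
    combinations are computed from the rules for moving e+, e-, e0 past the
    generators and past each other ([frame_rel]).  The formulas defining e+,
    e-, e0 make sense in any algebra B with an algebra map i : A -> B and a
    derivation D : A -> B along i.  [SUq2_calculus_extension] says that if the
    three resulting elements E+, E-, E0 of B satisfy the same rules, then there
    is an algebra map Om -> B with x |-> i x and dx |-> D x.  Its graph is
    built directly: it is the left A-span, in the product algebra Om x B, of
    the eight monomials in the pairs (e, E).  The rules make the span a
    subalgebra ([frame_span_subalg]), the basis property of Om makes it the
    graph of a function ([monomials_span], [monomials_free]), and expressing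
    the differentials of the generators in the frame puts the pairs (dx, D x)
    into it ([differential_in_span]).

    For B = G and D = d o phi the frame is
      E+ = e+ (x) t^2,  E- = e- (x) t^-2,  E0 = e0 (x) 1 + 1 (x) t^-1 dt :
    the terms in dt cancel in E+ and E- because ca = q ac and db = q bd, and
    in E0 their coefficient is the quantum determinant 1.  The rules then hold
    ([coact_frame_rel]): the factor q^2 in dt t = q^2 t dt is the one by which
    e0 commutes with the generators of degree 1, and its square q^4 matches the
    factor between e0 and e+.  Finally, an algebra map that respects d on A is
    automatically a morphism of differential graded algebras, since Om is
    spanned by the forms x dy1 ... dyk ([dga_morphism_of_degree0]). *)

(** * Subalgebras and maps given by their graphs *)

Section Subalgebras.
Variable K : fieldType.

Record subalgebra (B : algType K) (S : B -> Prop) : Prop := Subalgebra {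
  subalg1 : S 1;
  subalgP : forall (c : K) x y, S x -> S y -> S (c *: x + y);
  subalgM : forall x y, S x -> S y -> S (x * y)
}.

Lemma generates_subalg (A : algType K) (s : seq A) (S : A -> Prop) :
  generates s -> subalgebra S -> (forall x, x \in s -> S x) -> forall x, S x.
Proof. by move=> gen [S1 SP SM] Ss; apply: gen. Qed.

(** A subalgebra of B x C is the graph of a relation compatible with all the
    operations; by linearity it is single-valued as soon as 0 has one image. *)
Lemma functional_graph_morphism (B C : algType K) (S : (B * C)%type -> Prop) :
  subalgebra S -> (forall x, exists y, S (x, y)) ->
  (forall y, S (0, y) -> y = 0) ->
  exists f : {lrmorphism B -> C}, forall x y, S (x, y) -> f x = y.
Proof.
move=> SA tot fun0.
have uniq x y y' : S (x, y) -> S (x, y') -> y = y'.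
  move=> Sy Sy'; apply/eqP; rewrite eq_sym -subr_eq0; apply/eqP/fun0.
  have := subalgP SA (-1) Sy Sy'.
  suff -> : -1 *: (x, y) + (x, y') = (0, y' - y) by [].
  by rewrite scaleN1r; congr (_, _); rewrite /= addrC ?subrr.
pose f x := sval (cid (tot x)).
have fS x : S (x, f x) := svalP (cid (tot x)).
have f_lin : linear f.
  by move=> a x y; apply: uniq (fS _) _; exact: (subalgP SA a (fS x) (fS y)).
have f_mul : monoid_morphism f.
  split=> [|x y]; first by apply: uniq (fS _) _; exact: (subalg1 SA).
  by apply: uniq (fS _) _; exact: (subalgM SA (fS x) (fS y)).
pose fL := GRing.isLinear.Build K B C _ f f_lin.
pose fM := GRing.isMonoidMorphism.Build B C f f_mul.
pose F : {lrmorphism B -> C} := HB.pack f fL fM.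
by exists F => x y Sxy; apply: uniq (fS _) Sxy.
Qed.

End Subalgebras.

Section PairMorphism.
Variables (K : fieldType) (A B C : algType K).
Variables (i : {lrmorphism A -> B}) (j : {lrmorphism A -> C}).

Definition pair_morphism (x : A) : (B * C)%type := (i x, j x).

Fact pair_morphism_linear : linear pair_morphism.
Proof. by move=> r x y; rewrite /pair_morphism !linearP. Qed.
Fact pair_morphism_monoid : monoid_morphism pair_morphism.
Proof. by split=> [|x y]; rewrite /pair_morphism ?rmorph1 ?rmorphM. Qed.
HB.instance Definition _ :=
  GRing.isLinear.Build K A (B * C)%type _ pair_morphism pair_morphism_linear.
HB.instance Definition _ := GRing.isMonoidMorphism.Build A (B * C)%type
  pair_morphism pair_morphism_monoid.
End PairMorphism.

(** * Left spans along an algebra map *)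

Section LeftSpan.
Variables (K : fieldType) (A B : algType K) (i : {lrmorphism A -> B}).

Definition left_comb (l : seq B) (c : 'I_(size l) -> A) : B :=
  \sum_(k < size l) i (c k) * l`_k.
Definition left_span (l : seq B) (w : B) : Prop := exists c, w = @left_comb l c.

Section Fixed.
Variable l : seq B.

Lemma left_spanP (x : K) u v :
  left_span l u -> left_span l v -> left_span l (x *: u + v).
Proof.
move=> [c ->] [c' ->]; exists (fun k => x *: c k + c' k).
rewrite /left_comb scaler_sumr -big_split; apply: eq_bigr => k _ /=.
by rewrite linearP mulrDl scalerAl.
Qed.

Lemma left_span0 : left_span l 0.
Proof. by exists (fun=> 0); rewrite /left_comb big1 // => k _; rewrite linear0 mul0r. Qed.

Lemma left_spanZ x u : left_span l u -> left_span l (x *: u).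
Proof. by move=> lu; rewrite -[_ *: _]addr0; apply: left_spanP => //; exact: left_span0. Qed.

Lemma left_spanD u v : left_span l u -> left_span l v -> left_span l (u + v).
Proof. by move=> lu lv; rewrite -[u]scale1r; exact: left_spanP. Qed.

Lemma left_spanMl a u : left_span l u -> left_span l (i a * u).
Proof.
move=> [c ->]; exists (fun k => a * c k).
by rewrite /left_comb mulr_sumr; apply: eq_bigr => k _; rewrite rmorphM mulrA.
Qed.

Lemma left_span_mem m : m \in l -> left_span l m.
Proof.
move=> /(nthP 0)[k kl <-]; exists (fun j => (j == Ordinal kl)%:R).
rewrite /left_comb (bigD1 (Ordinal kl)) //= eqxx rmorph1 mul1r big1 ?addr0 //.
by move=> j /negPf ->; rewrite linear0 mul0r.
Qed.

Lemma left_span_ind (S : B -> Prop) : S 0 ->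
  (forall u v, S u -> S v -> S (u + v)) ->
  (forall a m, m \in l -> S (i a * m)) -> forall w, left_span l w -> S w.
Proof.
move=> S0 SD Sm w [c ->]; rewrite /left_comb; elim/big_ind: _ => // k _.
by apply: Sm; rewrite mem_nth.
Qed.

(** Moving i a to the left of x reduces stability under x to the products of x
    with the spanning elements. *)
Lemma left_span_stable x :
  (forall a, exists a', x * i a = i a' * x) ->
  (forall m, m \in l -> left_span l (x * m)) ->
  forall w, left_span l w -> left_span l (x * w).
Proof.
move=> xC xl; apply: left_span_ind => [|u v hu hv|a m ml].
- by rewrite mulr0; exact: left_span0.
- by rewrite mulrDr; exact: left_spanD.
have [a' xa] := xC a; rewrite mulrA xa -mulrA; apply: left_spanMl; exact: xl.
Qed.

(** Since the span is a left A-module, closure under all products follows from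
    closure under left multiplication by each spanning element. *)
Lemma left_span_subalg : left_span l 1 ->
  (forall m, m \in l -> forall w, left_span l w -> left_span l (m * w)) ->
  subalgebra (left_span l).
Proof.
move=> l1 lM; split=> // [c u v|u w lu lw]; first exact: left_spanP.
move: u lu; apply: left_span_ind => [|u v hu hv|a m ml].
- by rewrite mul0r; exact: left_span0.
- by rewrite mulrDl; exact: left_spanD.
by rewrite -mulrA; apply/left_spanMl/lM.
Qed.
End Fixed.

Lemma left_span_sub (l l' : seq B) w :
  {subset l <= l'} -> left_span l w -> left_span l' w.
Proof.
move=> ll'; move: w; apply: left_span_ind => [|u v hu hv|a m ml].
- exact: left_span0.
- exact: left_spanD.
by apply: left_spanMl; apply: left_span_mem; exact: ll'.
Qed.
End LeftSpan.

(** * The frame relations *)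

Section Frame.
Variables (K : fieldType) (q : K) (A : algType K) (a b c d : A).

Section InAlgebra.
Variables (B : algType K) (i : {lrmorphism A -> B}).

(** The relations between e+, e-, e0 (here x, y, z) and the generators of A,
    for an arbitrary target B: the point is to compare the frame of the
    calculus with its image in another algebra. *)
Record frame_rel (x y z : B) : Prop := FrameRel {
  frame_xC : forall f n, (f, n) \in gen_degrees a b c d ->
    x * i f = q ^ n *: (i f * x);
  frame_yC : forall f n, (f, n) \in gen_degrees a b c d ->
    y * i f = q ^ n *: (i f * y);
  frame_zC : forall f n, (f, n) \in gen_degrees a b c d ->
    z * i f = q ^ (2 * n) *: (i f * z);
  frame_xy : x * y = - q ^- 2 *: (y * x);
  frame_xz : x * z = - q ^- 4 *: (z * x);
  frame_yz : y * z = - q ^+ 4 *: (z * y);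
  frame_xx : x * x = 0;
  frame_yy : y * y = 0;
  frame_zz : z * z = 0
}.

Definition frame_monomials (x y z : B) : seq B :=
  [:: 1; x; y; z; x * y; x * z; y * z; x * y * z].

Section Rel.
Hypothesis (q0 : q != 0) (A_gen : generates [:: a; b; c; d]).

(** The elements that can be moved past x form a subalgebra, so that it
    suffices to know the generators; this avoids constructing the
    automorphism f |-> f'. *)
Lemma frame_comm (x : B) :
  (forall f, f \in [:: a; b; c; d] -> exists r : K, x * i f = r *: (i f * x)) ->
  forall f, exists f', x * i f = i f' * x.
Proof.
move=> xC; apply: (generates_subalg A_gen) => [|f /xC[r xf]]; last first.
  by exists (r *: f); rewrite linearZ /= -scalerAl.
split=> [|r f g [f' xf] [g' xg]|f g [f' xf] [g' xg]].
- by exists 1; rewrite rmorph1 mulr1 mul1r.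
- exists (r *: f' + g').
  by rewrite !linearP mulrDl mulrDr -scalerAl -scalerAr xf xg.
by exists (f' * g'); rewrite !rmorphM mulrA xf -mulrA xg mulrA.
Qed.

Lemma gen_degreesP f : f \in [:: a; b; c; d] ->
  exists n, (f, n) \in gen_degrees a b c d.
Proof.
rewrite !inE => /or4P[]/eqP ->; [exists 1|exists (-1)|exists 1|exists (-1)];
  by rewrite !inE eqxx ?orbT.
Qed.

(** The quadratic relations reorder any product of x, y, z, up to a scalar, to
    one of the eight monomials or to 0. *)
Lemma frame_span_subalg (x y z : B) : frame_rel x y z ->
  subalgebra (left_span i (frame_monomials x y z)).
Proof.
move=> fr; set l := frame_monomials x y z; set S := left_span i l.
have q20 : q ^+ 2 != 0 by rewrite expf_neq0.
have q40 : q ^+ 4 != 0 by rewrite expf_neq0.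
have yx : y * x = - q ^+ 2 *: (x * y).
  by rewrite (frame_xy fr) scalerA mulrNN mulfV // scale1r.
have zx : z * x = - q ^+ 4 *: (x * z).
  by rewrite (frame_xz fr) scalerA mulrNN mulfV // scale1r.
have zy : z * y = - q ^- 4 *: (y * z).
  by rewrite (frame_yz fr) scalerA mulrNN mulVf // scale1r.
have [[xx yy] zz] := (frame_xx fr, frame_yy fr, frame_zz fr).
have Sl m : m \in l -> S m by exact: left_span_mem.
have S0 : S 0 by exact: left_span0.
have [S1 [Sx [Sy [Sz [Sxy [Sxz [Syz Sxyz]]]]]]] :
    S 1 /\ S x /\ S y /\ S z /\ S (x * y) /\ S (x * z) /\ S (y * z) /\ S (x * y * z).
  by do !split; apply: Sl; rewrite !inE eqxx ?orbT.
have SZ r u : S u -> S (r *: u) by exact: left_spanZ.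
have stab u : (forall f n, (f, n) \in gen_degrees a b c d ->
      exists r : K, u * i f = r *: (i f * u)) ->
    (forall m, m \in l -> S (u * m)) -> forall w, S w -> S (u * w).
  move=> uC; apply: left_span_stable; apply: frame_comm => f.
  by move=> /gen_degreesP[n /uC].
have xS : forall w, S w -> S (x * w).
  apply: stab => [f n /(frame_xC fr) ->|m]; first by exists (q ^ n).
  rewrite !inE => /or4P[| | |/or4P[| | |/orP[]]] /eqP ->;
    by rewrite ?mulr1 ?mulrA ?xx ?mul0r.
have yS : forall w, S w -> S (y * w).
  apply: stab => [f n /(frame_yC fr) ->|m]; first by exists (q ^ n).
  rewrite !inE => /or4P[| | |/or4P[| | |/orP[]]] /eqP ->;
    by rewrite ?mulr1 ?mulrA ?yx -?scalerAl -?[x * y * y]mulrA ?yy ?mulr0 ?mul0r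
      ?scaler0; auto.
have zS : forall w, S w -> S (z * w).
  apply: stab => [f n /(frame_zC fr) ->|m]; first by exists (q ^ (2 * n)).
  have zxy : z * x * y = (q ^+ 4 * q ^- 4) *: (x * y * z).
    by rewrite zx -scalerAl -[x * z * y]mulrA zy -scalerAr scalerA mulrNN mulrA.
  have xzz : x * z * z = 0 by rewrite -mulrA zz mulr0.
  have yzz : y * z * z = 0 by rewrite -mulrA zz mulr0.
  have xyzz : x * y * z * z = 0 by rewrite -mulrA zz mulr0.
  rewrite !inE => /or4P[| | |/or4P[| | |/orP[]]] /eqP ->;
    by rewrite ?mulr1 ?mulrA ?zxy -?scalerAl ?xyzz ?zx ?zy -?scalerAl ?zz ?xzz ?yzz
      ?scaler0; auto.
apply: left_span_subalg => // m.
rewrite !inE => /or4P[| | |/or4P[| | |/orP[]]] /eqP -> w; rewrite -/S => Sw;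
  by rewrite ?mul1r -?mulrA -/S; auto.
Qed.
End Rel.
End InAlgebra.
End Frame.

(** * The differentials of the generators in the frame *)

Section Differentials.
Variables (K : fieldType) (q : K) (A : algType K) (a b c d : A).
Variables (B : algType K) (i : {lrmorphism A -> B}) (D : A -> B).

Record derivation : Prop := Derivation {
  derivation_lin : linear D;
  derivationM : forall x y, D (x * y) = D x * i y + i x * D y
}.

Definition frame_plus : B := q^-1 *: (i a * D c) - q ^- 2 *: (i c * D a).
Definition frame_minus : B := i d * D b - q *: (i b * D d).
Definition frame_zero : B := i d * D a - q *: (i b * D c).

Hypotheses (q0 : q != 0) (A_rel : SUq2_rel q a b c d) (D_der : derivation).
Local Notation xp := frame_plus.
Local Notation xm := frame_minus.
Local Notation xz := frame_zero.
Hypothesis fr : frame_rel q a b c d i xp xm xz.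

Lemma derivation1 : D 1 = 0.
Proof.
have := derivationM D_der 1 1; rewrite !rmorph1 !mulr1 mul1r => /eqP.
by rewrite -{1}[D 1]addr0 (inj_eq (addrI _)) eq_sym => /eqP.
Qed.

Lemma derivationB r x y : D (x - r *: y) = D x - r *: D y.
Proof.
by rewrite addrC -scaleNr (derivation_lin D_der) addrC scaleNr.
Qed.

(** The commutator of d and a turns the quantum determinant a d - q^-1 b c into
    its form with a and d exchanged. *)
Lemma SUq2_det_rev : d * a - q *: (c * b) = 1.
Proof.
have da : d * a = (q - q^-1) *: (b * c) + a * d.
  by apply/eqP; rewrite -subr_eq; apply/eqP/(SUq2_da A_rel).
rewrite (SUq2_cb A_rel) da -(SUq2_det A_rel) scalerBl.
by rewrite addrAC [X in X + _]addrAC subrr add0r addrC.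
Qed.

(** The column (u, v) is recovered from its two products with the rows
    (d, - q b) and (- q^-1 c, a) of the quantum cofactor matrix.  With
    (u, v) = (D a, D c) these products are e0 and q e+; with
    (u, v) = (D b, D d) they are e- and - q^-2 e0. *)
Lemma cofactor_expansion (u v : B) x y :
  i x * (i d * u - q *: (i b * v)) + i y * (i a * v - q^-1 *: (i c * u)) =
  i (x * d - q^-1 *: (y * c)) * u + i (y * a - q *: (x * b)) * v.
Proof.
have iZ r z : i (r *: z) = r *: i z by rewrite linearZ.
rewrite !mulrBr !rmorphB !mulrBl /= !iZ !rmorphM -!scalerAr -!scalerAl !mulrA.
by rewrite addrACA [RHS]addrACA; congr (_ + _); rewrite addrC.
Qed.

Lemma cofactor_top (u v : B) :
  i a * (i d * u - q *: (i b * v)) + i b * (i a * v - q^-1 *: (i c * u)) = u.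
Proof.
rewrite cofactor_expansion (SUq2_det A_rel) (SUq2_ba A_rel) subrr.
by rewrite rmorph1 rmorph0 mul1r mul0r addr0.
Qed.

Lemma cofactor_bottom (u v : B) :
  i c * (i d * u - q *: (i b * v)) + i d * (i a * v - q^-1 *: (i c * u)) = v.
Proof.
rewrite cofactor_expansion SUq2_det_rev (SUq2_dc A_rel) scalerA mulVf // scale1r subrr.
by rewrite rmorph1 rmorph0 mul1r mul0r add0r.
Qed.

Lemma frame_plusE : i a * D c - q^-1 *: (i c * D a) = q *: xp.
Proof.
rewrite /frame_plus scalerBr !scalerA mulfV // scale1r exprS invfM mulrA mulfV //.
by rewrite mul1r expr1.
Qed.

Lemma differential_a : D a = i a * xz + q *: (i b * xp).
Proof. by rewrite scalerAr -frame_plusE cofactor_top. Qed.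

Lemma differential_c : D c = i c * xz + q *: (i d * xp).
Proof. by rewrite scalerAr -frame_plusE cofactor_bottom. Qed.

(** The definition of e0 involves D a and D c only.  Differentiating the
    relation a d - q^-1 c b = 1 gives a second expression, in D b and D d,
    once e0 and e+ are moved past b and d. *)
Lemma frame_zeroE : i a * D d - q^-1 *: (i c * D b) = - q ^- 2 *: xz.
Proof.
have degb : (b, -1) \in gen_degrees a b c d by rewrite !inE eqxx !orbT.
have degd : (d, -1) \in gen_degrees a b c d by rewrite !inE eqxx !orbT.
have pb : xp * i b = q^-1 *: (i b * xp) := frame_xC fr degb.
have pd : xp * i d = q^-1 *: (i d * xp) := frame_xC fr degd.
have zb : xz * i b = q ^- 2 *: (i b * xz) := frame_zC fr degb.
have zd : xz * i d = q ^- 2 *: (i d * xz) := frame_zC fr degd.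
have ad : i a * D d = D (a * d) - D a * i d.
  by rewrite (derivationM D_der) addrAC subrr add0r.
have cb : i c * D b = D (c * b) - D c * i b.
  by rewrite (derivationM D_der) addrAC subrr add0r.
have Dad : D (a * d) = q^-1 *: D (c * b).
  apply/eqP; rewrite -subr_eq0 -derivationB (SUq2_cb A_rel) (SUq2_det A_rel).
  by rewrite derivation1.
rewrite ad cb Dad scalerBr opprB addrC addrA subrK.
rewrite differential_a differential_c !mulrDl -!scalerAl -!mulrA zb pb zd pd.
rewrite -!scalerAr !scalerA !mulrA.
have iZ r x : i (r *: x) = r *: i x by rewrite linearZ.
rewrite scalerDr !scalerA mulfV // mulr1 scale1r -!rmorphM /=.
rewrite (SUq2_db A_rel) iZ -scalerAl scalerA mulVf // scale1r.
rewrite opprD addrACA addrN addr0 (SUq2_cb A_rel).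
rewrite -[in RHS](mul1r xz) -(rmorph1 i) -(SUq2_det A_rel) rmorphB /= iZ.
by rewrite mulrBl scaleNr scalerBr opprB -scalerAl scalerA mulrC.
Qed.

Lemma differential_b : D b = i a * xm - q ^- 2 *: (i b * xz).
Proof. by rewrite -scaleNr scalerAr -frame_zeroE cofactor_top. Qed.

Lemma differential_d : D d = i c * xm - q ^- 2 *: (i d * xz).
Proof. by rewrite -scaleNr scalerAr -frame_zeroE cofactor_bottom. Qed.

(** By the Leibniz rule, the x with D x in a subalgebra containing the image of i
    form a subalgebra, so that the four generators suffice. *)
Lemma differential_in_span f : generates [:: a; b; c; d] ->
  left_span i (frame_monomials xp xm xz) (D f).
Proof.
move=> A_gen; set l := frame_monomials _ _ _.
have SA : subalgebra (left_span i l) by exact: frame_span_subalg fr.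
have Si x : left_span i l (i x).
  by rewrite -[i x]mulr1; apply/left_spanMl/(subalg1 SA).
have Sx m : m \in [:: xp; xm; xz] -> left_span i l m.
  by rewrite !inE => /or3P[]/eqP ->; apply: left_span_mem; rewrite !inE eqxx ?orbT.
have Sp : left_span i l xp by apply: Sx; rewrite !inE eqxx.
have Sm : left_span i l xm by apply: Sx; rewrite !inE eqxx orbT.
have Sz : left_span i l xz by apply: Sx; rewrite !inE eqxx !orbT.
move: f; apply: (generates_subalg A_gen) => [|f].
  split=> [|r x y Dx Dy|x y Dx Dy].
  - by rewrite derivation1; exact: left_span0.
  - by rewrite (derivation_lin D_der); exact: left_spanP.
  rewrite (derivationM D_der); apply: left_spanD; apply: (subalgM SA) => //.
rewrite !inE => /or4P[]/eqP ->;
  rewrite ?differential_a ?differential_b ?differential_c ?differential_d -?scaleNr.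
all: by apply: left_spanD; try apply: left_spanZ; exact: left_spanMl.
Qed.
End Differentials.

(** * Forms generated in degree 0 *)

Section Exact.
Variable K : fieldType.
Implicit Type Om : dga K.

Lemma homog_dd0 Om (x : Om) : homog 0 x -> homog 1 (dd x).
Proof. exact: homogd. Qed.

Lemma homog_sum Om k (I : Type) (s : seq I) (F : I -> Om) :
  (forall p, homog k (F p)) -> homog k (\sum_(p <- s) F p).
Proof.
by move=> hF; rewrite /homog linear_sum; apply: eq_bigr => p _; exact: hF.
Qed.

Lemma homog_prod_dd Om (T : Type) (F : T -> Om) (s : seq T) :
  (forall b, homog 0 (F b)) -> homog (size s) (\prod_(b <- s) dd (F b)).
Proof.
move=> hF; elim: s => [|b s IH]; first by rewrite big_nil; exact: homog1.
by rewrite big_cons; exact: (homogM (homog_dd0 (hF b)) IH).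
Qed.

Lemma dd_prod_dd Om (T : Type) (F : T -> Om) (s : seq T) :
  (forall b, homog 0 (F b)) -> dd (\prod_(b <- s) dd (F b)) = 0.
Proof.
move=> hF; elim: s => [|b s IH].
  have := ddM (1 : Om) (homog1 Om); rewrite big_nil !mulr1 mul1r expr0 scale1r => /eqP.
  by rewrite -{1}[dd 1]addr0 (inj_eq (addrI _)) eq_sym => /eqP.
by rewrite big_cons (ddM _ (homog_dd0 (hF b))) ddK IH mul0r mulr0 scaler0 addr0.
Qed.

Lemma cemb_homog (A : algType K) (Om : calculus A) x : homog 0 (cemb Om x).
Proof. by apply/cemb_deg0; exists x. Qed.

(** Both sides of f d = d f are determined on x dy1 ... dyk by the Leibniz rule,
    because a product of exact forms is closed. *)
Lemma dga_morphism_of_degree0 (A : algType K) (Om : calculus A) (Om' : dga K)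
    (f : {lrmorphism Om -> Om'}) :
  (forall x, homog 0 (f (cemb Om x))) ->
  (forall x, f (dd (cemb Om x)) = dd (f (cemb Om x))) -> dga_morphism f.
Proof.
move=> f0 fd.
have fE x (s : seq A) : f (cemb Om x * \prod_(b <- s) dd (cemb Om b)) =
    f (cemb Om x) * \prod_(b <- s) dd (f (cemb Om b)).
  by rewrite rmorphM rmorph_prod; congr (_ * _); apply: eq_bigr => b _; exact: fd.
split=> [k w /calc_span[s ->]|w].
  rewrite linear_sum; apply: homog_sum => -[x l] /=; rewrite fE.
  have hl := homog_prod_dd (F := fun b => f (cemb Om b)) l f0.
  by rewrite size_tuple in hl; exact: (homogM (f0 x) hl).
elim/homog_ind: w => [k w /calc_span[s ->]|x y fx fy]; last by rewrite !linearD /= fx fy.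
rewrite !linear_sum; apply: eq_bigr => -[x l] _ /=; rewrite fE.
have hA b : homog 0 (cemb Om b) by exact: cemb_homog.
rewrite (ddM _ (hA x)) (ddM _ (f0 x)) !dd_prod_dd // !mulr0 !scaler0 !addr0.
by rewrite -fd rmorphM rmorph_prod; congr (_ * _); apply: eq_bigr => b _; exact: fd.
Qed.

Lemma cemb_dd_derivation (A : algType K) (Om : calculus A) :
  derivation (cemb Om) (fun x => dd (cemb Om x)).
Proof.
split=> [r x y|x y]; first by rewrite !linearP.
by rewrite rmorphM (ddM _ (cemb_homog _ _)) expr0 scale1r.
Qed.
End Exact.

Section Freeness.
Variables (K : fieldType) (A : algType K) (Om : calculus A).

Lemma homog_cembM k x (w : Om) : homog k w -> homog k (cemb Om x * w).
Proof. by rewrite -[k]add0n; apply: homogM; exact: cemb_homog. Qed.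

Lemma left_basis_span k (e : seq Om) w :
  left_basis k e -> homog k w -> left_span (cemb Om) e w.
Proof.
by move=> [_ eB] /eB[c [-> _]]; exists (tnth c).
Qed.

Lemma left_basis_free k (e : seq Om) (g : nat -> A) : left_basis k e ->
  \sum_(n < size e) cemb Om (g n) * e`_n = 0 ->
  forall n, (n < size e)%N -> g n = 0.
Proof.
move=> [_ eB] g0 n ne.
have /eB[c [_ cU]] : homog k (0 : Om) by rewrite /homog linear0.
have c0 : c = [tuple 0 | _ < size e].
  by apply: cU; rewrite big1 // => i _; rewrite tnth_mktuple linear0 mul0r.
have cg : c = [tuple g i | i < size e].
  by apply: cU; rewrite -{1}g0; apply: eq_bigr => i _; rewrite tnth_mktuple.
have := congr1 (fun v : (size e).-tuple A => tnth v (Ordinal ne)) (etrans (esym cg) c0).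
by rewrite !tnth_mktuple.
Qed.
End Freeness.

(** * Extending algebra maps from the quantum group to its calculus *)

Section Extension.
Variables (K : fieldType) (q : K) (A : algType K) (a b c d : A).
Variable Om : calculus A.
Hypothesis Om_calc : is_SUq2_calculus q Om a b c d.
Local Notation ep := (eplus q Om a c).
Local Notation em := (eminus q Om b d).
Local Notation e0 := (ezero q Om a b c d).
Local Notation monomials := (frame_monomials ep em e0).

Lemma SUq2_frame_rel : frame_rel q a b c d (cemb Om) ep em e0.
Proof. by case: Om_calc. Qed.

Lemma monomials_span w : left_span (cemb Om) monomials w.
Proof.
have sub k (e : seq Om) v : left_basis k e -> {subset e <= monomials} ->
    homog k v -> left_span (cemb Om) monomials v.
  by move=> eB el /(left_basis_span eB); exact: left_span_sub.
elim/homog_ind: w => [k w|x y]; last exact: left_spanD.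
case: k => [/cemb_deg0[x ->]|[|[|[|k]]]].
- by rewrite -[cemb Om x]mulr1; apply/left_spanMl/left_span_mem; rewrite inE eqxx.
- apply: sub (SUq2_basis1 Om_calc) _ => m.
  by rewrite !inE => /or3P[]/eqP ->; rewrite eqxx ?orbT.
- apply: sub (SUq2_basis2 Om_calc) _ => m.
  by rewrite !inE => /or3P[]/eqP ->; rewrite eqxx ?orbT.
- apply: sub (SUq2_basis3 Om_calc) _ => m.
  by rewrite !inE => /eqP ->; rewrite eqxx ?orbT.
by move=> /(SUq2_deg4 Om_calc) -> //; exact: left_span0.
Qed.

(** Uniqueness of coefficients is known separately in each degree; the
    homogeneous components of a relation reduce to those cases. *)
Lemma monomials_free (g : 'I_8 -> A) :
  left_comb (cemb Om) (l := monomials) g = 0 -> forall k, g k = 0.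
Proof.
(* Coefficients indexed by nat, so that sums over 'I_8 can be unfolded. *)
pose h n := g (inord n); move=> gE.
have hE : \sum_(k < 8) cemb Om (h k) * monomials`_k = 0.
  by rewrite -[RHS]gE; apply: eq_bigr => k _; rewrite /h inord_val.
suff h0 : forall n, (n < 8)%N -> h n = 0 by move=> k; rewrite -(h0 k) // /h inord_val.
have [B1 B2 B3] :=
  And3 (SUq2_basis1 Om_calc) (SUq2_basis2 Om_calc) (SUq2_basis3 Om_calc).
pose deg k := nth 0%N [:: 0; 1; 1; 1; 2; 2; 2; 3]%N k.
have homm k : (k < 8)%N -> homog (deg k) monomials`_k.
  case: k => [_|[|[|[|k]]]]; first exact: homog1.
  - by move=> _; exact: (B1.1 (Ordinal (isT : 0 < 3)%N)).
  - by move=> _; exact: (B1.1 (Ordinal (isT : 1 < 3)%N)).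
  - by move=> _; exact: (B1.1 (Ordinal (isT : 2 < 3)%N)).
  case: k => [|[|[|[|k]]]] //.
  - by move=> _; exact: (B2.1 (Ordinal (isT : 0 < 3)%N)).
  - by move=> _; exact: (B2.1 (Ordinal (isT : 1 < 3)%N)).
  - by move=> _; exact: (B2.1 (Ordinal (isT : 2 < 3)%N)).
  by move=> _; exact: (B3.1 (Ordinal (isT : 0 < 1)%N)).
pose term n k := if n == deg k then cemb Om (h k) * monomials`_k else 0.
have part n : \sum_(k < 8) term n k = 0.
  rewrite -[RHS](linear0 (dcomp n)) -[in RHS]hE linear_sum; apply: eq_bigr => k _.
  by rewrite (homog_compE _ (homog_cembM _ (homm _ (ltn_ord k)))).
have split8 (F : nat -> Om) : \sum_(k < 8) F k =
  F 0 + F 1 + F 2 + F 3 + F 4 + F 5 + F 6 + F 7.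
  by rewrite !big_ord_recr big_ord0 /= add0r.
have free k (e : seq Om) m : left_basis k e ->
    \sum_(j < size e) cemb Om (h (m + j)%N) * e`_j = 0 ->
    forall j, (j < size e)%N -> h (m + j)%N = 0.
  by move=> eB; exact: (left_basis_free (g := fun j => h (m + j)%N) eB).
have h1 : h 0%N = 0.
  apply: (@cemb_inj _ _ Om); rewrite linear0 -(part 0%N) split8 /term /= !addr0.
  by rewrite mulr1.
have h2 := free _ _ 1%N B1; have h3 := free _ _ 4%N B2; have h4 := free _ _ 7%N B3.
have {}h2 : forall j, (j < 3)%N -> h (1 + j)%N = 0.
  by apply: h2; rewrite -[RHS](part 1%N) split8 /term /= !big_ord_recr big_ord0 /= !addr0 !add0r.
have {}h3 : forall j, (j < 3)%N -> h (4 + j)%N = 0.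
  by apply: h3; rewrite -[RHS](part 2%N) split8 /term /= !big_ord_recr big_ord0 /= !addr0 !add0r.
have {}h4 : forall j, (j < 1)%N -> h (7 + j)%N = 0.
  by apply: h4; rewrite -[RHS](part 3%N) split8 /term /= !big_ord_recr big_ord0 /= !addr0 !add0r.
case=> [|[|[|[|[|[|[|[|m]]]]]]]] // _; first [exact: (h2 0%N)|exact: (h2 1%N)
  |exact: (h2 2%N)|exact: (h3 0%N)|exact: (h3 1%N)|exact: (h3 2%N)|exact: (h4 0%N)].
Qed.

Hypotheses (q0 : q != 0) (A_rel : SUq2_rel q a b c d).
Hypothesis A_gen : generates [:: a; b; c; d].

(** The graph of f is the span of the monomials in the pairs (e, E) inside the
    product algebra Om x C, where the frame relations hold componentwise. *)
Theorem SUq2_calculus_extension (C : algType K) (j : {lrmorphism A -> C})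
    (D : A -> C) : derivation j D ->
  frame_rel q a b c d j (frame_plus q a c j D) (frame_minus q b d j D)
    (frame_zero q a b c d j D) ->
  exists f : {lrmorphism Om -> C},
    (forall x, f (cemb Om x) = j x) /\ (forall x, f (dd (cemb Om x)) = D x).
Proof.
move=> D_der fr.
pose i : {lrmorphism A -> (Om * C)%type} := pair_morphism (cemb Om) j.
pose DP x : (Om * C)%type := (dd (cemb Om x), D x).
pose xp := frame_plus q a c i DP; pose xm := frame_minus q b d i DP.
pose xz := frame_zero q a b c d i DP.
have pair_eq (u v : (Om * C)%type) : u.1 = v.1 -> u.2 = v.2 -> u = v.
  by case: u v => ? ? [? ?] /= -> ->.
have DP_der : derivation i DP.
  have D1 := cemb_dd_derivation Om.
  split=> [r x y|x y]; apply: pair_eq.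
  - exact: (derivation_lin D1).
  - exact: (derivation_lin D_der).
  - exact: (derivationM D1).
  - exact: (derivationM D_der).
have frP : frame_rel q a b c d i xp xm xz.
  have fr1 := SUq2_frame_rel.
  split=> [f n fn|f n fn|f n fn||||||]; apply: pair_eq.
  - exact: (frame_xC fr1 fn).
  - exact: (frame_xC fr fn).
  - exact: (frame_yC fr1 fn).
  - exact: (frame_yC fr fn).
  - exact: (frame_zC fr1 fn).
  - exact: (frame_zC fr fn).
  - exact: (frame_xy fr1).
  - exact: (frame_xy fr).
  - exact: (frame_xz fr1).
  - exact: (frame_xz fr).
  - exact: (frame_yz fr1).
  - exact: (frame_yz fr).
  - exact: (frame_xx fr1).
  - exact: (frame_xx fr).
  - exact: (frame_yy fr1).
  - exact: (frame_yy fr).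
  - exact: (frame_zz fr1).
  - exact: (frame_zz fr).
pose S := left_span i (frame_monomials xp xm xz).
have SA : subalgebra S by exact: frame_span_subalg frP.
have tot w : exists y, S (w, y).
  move: w (monomials_span w); apply: left_span_ind.
  - by exists 0; exact: left_span0.
  - by move=> u v [y Sy] [z Sz]; exists (y + z); exact: (left_spanD Sy Sz).
  move=> x m mon; have /mapP[M MS ->] : m \in map fst (frame_monomials xp xm xz) by [].
  exists (j x * M.2).
  by have := left_spanMl x (left_span_mem i MS); case: M {MS}.
have fun0 y : S (0, y) -> y = 0.
  move=> [g gE]; suff g0 k : g k = 0.
    have -> : y = ((0, y) : (Om * C)%type).2 by [].
    by rewrite gE /left_comb big1 // => k _; rewrite g0 linear0 mul0r.
  apply: (@monomials_free g); have -> : 0 = ((0, y) : (Om * C)%type).1 by [].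
  rewrite gE [RHS]linear_sum; apply: eq_bigr => -[n nlt] _ /=.
  by do 8 (case: n nlt => [|n] nlt //).
have [f fS] := functional_graph_morphism SA tot fun0.
exists f; split=> x; apply: fS; last exact: differential_in_span.
by have := left_spanMl x (subalg1 SA); rewrite mulr1.
Qed.
End Extension.

(** * The frame in the tensor product calculus *)

Section TensorCalculus.
Variables (K : fieldType) (H : hopf_algebra K) (OmH : calculus H).
Variables (A : comodule_algebra H) (OmA : calculus A).
Local Notation G := (dga_tensor OmA OmH).
Local Notation gtens w n := ((w ⊗ n : tensor OmA OmH) : G).
Local Notation ι := (cemb OmA).

Lemma gtensMl w n w' n' j : homog 0 n -> homog j w' ->
  gtens w n * gtens w' n' = gtens (w * w') (n * n').
Proof. by move=> hn hw; rewrite (gmulrE w n' hn hw) mul0n expr0 scale1r. Qed.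

Lemma gtensMr w n w' n' i : homog i n -> homog 0 w' ->
  gtens w n * gtens w' n' = gtens (w * w') (n * n').
Proof. by move=> hn hw; rewrite (gmulrE w n' hn hw) muln0 expr0 scale1r. Qed.

Lemma gtensM11 w n w' n' : homog 1 n -> homog 1 w' ->
  gtens w n * gtens w' n' = - gtens (w * w') (n * n').
Proof. by move=> hn hw; rewrite (gmulrE w n' hn hw) expr1 scaleN1r. Qed.

Lemma homog_gtens i j w n : homog i w -> homog j n -> homog (i + j) (gtens w n).
Proof. by move=> hw hn; rewrite /homog [LHS](gcompE _ hw hn) eqxx. Qed.

Lemma dd_gtens0 w n : homog 0 w -> dd (gtens w n) = gtens (dd w) n + gtens w (dd n).
Proof. by move=> hw; rewrite [LHS](gdE n hw) expr0 scale1r. Qed.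

Lemma gtens_bilin : bilin (fun w n => gtens w n).
Proof. exact: tens_bilin. Qed.

Lemma tmap_cembE x h : tmap ι (cemb OmH) (x ⊗ h) = ι x ⊗ cemb OmH h.
Proof.
rewrite /tmap tliftE //; split=> [v r u u'|u r v v'] /=; rewrite linearP.
  exact: (tens_bilin _ _).1.
exact: (tens_bilin _ _).2.
Qed.

Lemma tmap_cemb_linear : linear (tmap ι (cemb OmH)).
Proof.
apply: tlift_linear; split=> [v r u u'|u r v v'] /=; rewrite linearP.
  exact: (tens_bilin _ _).1.
exact: (tens_bilin _ _).2.
Qed.

(** The coaction, with values in the degree 0 part of the tensor product
    calculus; no signs occur there, so it is still an algebra map. *)
Definition coact_forms (x : A) : G := tmap ι (cemb OmH) (coact x).

Fact coact_forms_linear : linear coact_forms.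
Proof. by move=> r x y; rewrite /coact_forms linearP tmap_cemb_linear. Qed.

Lemma tmap_cembM (u v : tensor A H) :
  (tmap ι (cemb OmH) (u * v) : G) = (tmap ι (cemb OmH) u : G) * (tmap ι (cemb OmH) v : G).
Proof.
have D x y : tmap ι (cemb OmH) (x + y) = tmap ι (cemb OmH) x + tmap ι (cemb OmH) y.
  by rewrite -[x in LHS]scale1r tmap_cemb_linear scale1r.
elim/tens_ind: u => [x h|u u' hu hu']; last first.
  by rewrite mulrDl !D hu hu'; exact: (esym (@mulrDl G _ _ _)).
elim/tens_ind: v => [y k|v v' hv hv']; last first.
  by rewrite mulrDr !D hv hv'; exact: (esym (@mulrDr G _ _ _)).
rewrite [_ * _]tmulE !tmap_cembE (gtensMl _ _ (cemb_homog _ _) (cemb_homog _ _)).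
by rewrite !rmorphM.
Qed.

Fact coact_forms_monoid : monoid_morphism coact_forms.
Proof.
split=> [|x y]; rewrite /coact_forms.
  by rewrite rmorph1 [LHS]tmap_cembE !rmorph1.
by rewrite rmorphM tmap_cembM.
Qed.
HB.instance Definition _ := GRing.isLinear.Build K A G _ coact_forms coact_forms_linear.
HB.instance Definition _ :=
  GRing.isMonoidMorphism.Build A G coact_forms coact_forms_monoid.

Lemma homog_coact_forms x : homog 0 (coact_forms x).
Proof.
rewrite /coact_forms; elim/tens_ind: (coact x) => [y h|u v hu hv].
  by rewrite tmap_cembE; exact: (homog_gtens (cemb_homog _ _) (cemb_homog _ _)).
rewrite -[u]scale1r tmap_cemb_linear.
by rewrite /homog linearP hu hv.
Qed.

Lemma coact_forms_derivation :
  derivation coact_forms (fun x => dd (coact_forms x) : G).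
Proof.
split=> [r x y|x y]; first by rewrite !linearP.
by rewrite rmorphM (ddM _ (homog_coact_forms x)) expr0 scale1r.
Qed.

Variables (q : K) (t tV : H) (a b c d : A).
Hypotheses (q0 : q != 0) (H_OU1 : is_OU1 t tV) (H_calc : is_OU1_calculus q t OmH).
Hypothesis A_SUq2 : is_OqSU2 q t tV a b c d.
Hypothesis A_calc : is_SUq2_calculus q OmA a b c d.
Local Notation τ := (cemb OmH t).
Local Notation τV := (cemb OmH tV).
(** The invariant form t^-1 dt. *)
Definition theta : OmH := cemb OmH tV * dd (cemb OmH t).
Local Notation θ := theta.

Let τK : τ * τV = 1. Proof. by rewrite -rmorphM (OU1_mulV H_OU1) rmorph1. Qed.
Let τVK : τV * τ = 1. Proof. by rewrite -rmorphM (OU1_mulVl H_OU1) rmorph1. Qed.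
Let hτ : homog 0 τ. Proof. exact: cemb_homog. Qed.
Let hτV : homog 0 τV. Proof. exact: cemb_homog. Qed.
Let hA x : homog 0 (ι x). Proof. exact: cemb_homog. Qed.
Let hdA x : homog 1 (dd (ι x)). Proof. exact: homog_dd0. Qed.
Let hθ : homog 1 θ. Proof. exact: (homogM hτV (homog_dd0 hτ)). Qed.
Let A_rel := OqSU2_rel A_SUq2.

Lemma theta_t : θ * τ = q ^+ 2 *: (τ * θ).
Proof. by rewrite /theta -mulrA (OU1_dt H_calc) -scalerAr !mulrA τVK τK. Qed.

Lemma theta_tV : θ * τV = q ^- 2 *: (τV * θ).
Proof.
have : τV * (θ * τ) * τV = q ^+ 2 *: (τV * (τ * θ) * τV).
  by rewrite theta_t -scalerAr -scalerAl.
rewrite [τV * (τ * θ)]mulrA τVK mul1r -!mulrA τK mulr1 => ->.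
by rewrite scalerA mulVf ?expf_neq0 // scale1r.
Qed.

Lemma theta_sq : θ * θ = 0.
Proof. exact: (OU1_deg2 H_calc (leqnn 2) (homogM hθ hθ)). Qed.

(** The three frame elements have the shape r f dg - s f' dg'; the second
    summand below is the obstruction r f g - s f' g', which a relation of A
    makes 0 (for e+ and e-) or 1 (for e0). *)
Lemma frame_gtens (r s : K) f g f' g' u v : homog 0 u -> homog 0 v ->
  r *: (gtens (ι f) u * dd (gtens (ι g) v)) - s *: (gtens (ι f') u * dd (gtens (ι g') v))
  = gtens (r *: (ι f * dd (ι g)) - s *: (ι f' * dd (ι g'))) (u * v)
    + gtens (ι (r *: (f * g) - s *: (f' * g'))) (u * dd v).
Proof.
move=> hu hv; have B := gtens_bilin.
have e x y : gtens (ι x) u * dd (gtens (ι y) v) =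
    gtens (ι x * dd (ι y)) (u * v) + gtens (ι (x * y)) (u * dd v).
  rewrite (dd_gtens0 v (hA y)) mulrDr (gtensMl _ _ hu (hdA y)).
  by rewrite (gtensMl _ _ hu (hA y)) rmorphM.
have -> : ι (r *: (f * g) - s *: (f' * g')) = r *: ι (f * g) - s *: ι (f' * g').
  by rewrite linearB !linearZ.
rewrite !e -!scaleNr !(bilinDl B) !(bilinZl B) !scalerDr.
by rewrite addrACA.
Qed.

Local Notation φ := coact_forms.
Local Notation Dφ := (fun x => dd (coact_forms x) : G).
Local Notation ep := (eplus q OmA a c).
Local Notation em := (eminus q OmA b d).
Local Notation e0 := (ezero q OmA a b c d).

Lemma coact_forms_gens : [/\ φ a = gtens (ι a) τ, φ b = gtens (ι b) τV,
  φ c = gtens (ι c) τ & φ d = gtens (ι d) τV].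
Proof.
split; rewrite /coact_forms ?(OqSU2_coact_a A_SUq2) ?(OqSU2_coact_b A_SUq2)
  ?(OqSU2_coact_c A_SUq2) ?(OqSU2_coact_d A_SUq2); exact: tmap_cembE.
Qed.

Lemma frame_plus_coact : frame_plus q a c φ Dφ = gtens ep (τ * τ).
Proof.
have [φa φb φc φd] := coact_forms_gens.
rewrite /frame_plus /= φa φc frame_gtens // (SUq2_ca A_rel) scalerA.
have -> : q ^- 2 * q = q^-1 by rewrite exprS invfM -mulrA expr1 mulVf // mulr1.
by rewrite subrr linear0 (bilin0l gtens_bilin) addr0.
Qed.

Lemma frame_minus_coact : frame_minus q b d φ Dφ = gtens em (τV * τV).
Proof.
have [φa φb φc φd] := coact_forms_gens.
rewrite /frame_minus /= φb φd -[_ * _ in X in X - _]scale1r frame_gtens //.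
by rewrite !scale1r (SUq2_db A_rel) subrr linear0 (bilin0l gtens_bilin) addr0.
Qed.

Lemma frame_zero_coact :
  frame_zero q a b c d φ Dφ = gtens e0 1 + gtens 1 θ.
Proof.
have [φa φb φc φd] := coact_forms_gens.
rewrite /frame_zero /= φa φb φc φd -[_ * _ in X in X - _]scale1r frame_gtens //.
by rewrite !scale1r τVK -(SUq2_cb A_rel) (SUq2_det_rev A_rel) rmorph1.
Qed.

Lemma coact_forms_gen f n : (f, n) \in gen_degrees a b c d ->
  exists u, [/\ φ f = gtens (ι f) u, homog 0 u, τ * u = u * τ, τV * u = u * τV
    & θ * u = q ^ (2 * n) *: (u * θ)].
Proof.
have [φa φb φc φd] := coact_forms_gens.
have τC : τ * τV = τV * τ by rewrite τK τVK.
rewrite !inE => /or4P[]/eqP[-> ->]; [exists τ|exists τV|exists τ|exists τV];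
  by split=> //; first [exact: theta_t|exact: theta_tV].
Qed.

Lemma gtens_comm (r : K) x n f u : homog 1 x -> homog 0 n -> homog 0 u ->
  x * ι f = r *: (ι f * x) -> n * u = u * n ->
  gtens x n * gtens (ι f) u = r *: (gtens (ι f) u * gtens x n).
Proof.
move=> hx hn hu xf nu.
rewrite (gtensMl _ _ hn (hA f)) (gtensMl _ _ hu hx) xf nu.
exact: (bilinZl gtens_bilin).
Qed.

Lemma frame_zero_mulr x n : homog 1 x -> homog 0 n ->
  (gtens e0 1 + gtens 1 θ) * gtens x n = gtens (e0 * x) n - gtens x (θ * n).
Proof.
move=> hx hn; rewrite mulrDl (gtensMl _ _ (homog1 OmH) hx) (gtensM11 _ _ hθ hx).
by rewrite !mul1r.
Qed.

Lemma frame_zero_mull x n : homog 1 x -> homog 0 n -> homog 1 e0 ->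
  gtens x n * (gtens e0 1 + gtens 1 θ) = gtens (x * e0) n + gtens x (n * θ).
Proof.
move=> hx hn he0; rewrite mulrDr (gtensMl _ _ hn he0) (gtensMl _ _ hn (homog1 OmA)).
by rewrite !mulr1.
Qed.

(** The sign of the graded product turns the exchange of theta and x, both of
    degree 1, into the sign of the relation between x and e0. *)
Lemma gtens_frame_zero_comm (r : K) x n : homog 1 x -> homog 0 n -> homog 1 e0 ->
  x * e0 = - r *: (e0 * x) -> r *: (θ * n) = n * θ ->
  gtens x n * (gtens e0 1 + gtens 1 θ)
    = - r *: ((gtens e0 1 + gtens 1 θ) * gtens x n).
Proof.
move=> hx hn he0 xe0 nθ; rewrite frame_zero_mull // frame_zero_mulr // xe0 -nθ.
have B := gtens_bilin; rewrite (bilinZl B) (bilinZr B) scalerBr.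
by rewrite [X in _ = _ - X]scaleNr opprK.
Qed.

(** The square of E0 vanishes because the two mixed terms e0 (x) theta come with
    opposite signs and theta has square 0. *)
Lemma coact_frame_rel : frame_rel q a b c d φ
  (frame_plus q a c φ Dφ) (frame_minus q b d φ Dφ) (frame_zero q a b c d φ Dφ).
Proof.
have [B1 _] := SUq2_basis1 A_calc.
have hp : homog 1 ep := B1 (Ordinal (isT : 0 < 3)%N).
have hm : homog 1 em := B1 (Ordinal (isT : 1 < 3)%N).
have h0 : homog 1 e0 := B1 (Ordinal (isT : 2 < 3)%N).
have hττ : homog 0 (τ * τ) by exact: (homogM hτ hτ).
have hτVτV : homog 0 (τV * τV) by exact: (homogM hτV hτV).
have τττV : τ * τ * (τV * τV) = 1 by rewrite mulrA -(mulrA τ) τK mulr1 τK.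
have τVτVτ : τV * τV * (τ * τ) = 1 by rewrite mulrA -(mulrA τV) τVK mulr1 τVK.
have θττ : θ * (τ * τ) = q ^+ 4 *: (τ * τ * θ).
  rewrite mulrA theta_t -scalerAl -[τ * θ * τ]mulrA theta_t.
  by rewrite -scalerAr scalerA -exprD mulrA.
have θττV : θ * (τV * τV) = q ^- 4 *: (τV * τV * θ).
  rewrite mulrA theta_tV -scalerAl -[τV * θ * τV]mulrA theta_tV.
  by rewrite -scalerAr scalerA -invfM -exprD mulrA.
have B := gtens_bilin.
rewrite frame_plus_coact frame_minus_coact frame_zero_coact; split.
- move=> f n fn; have [u [φf hu τu _ _]] := coact_forms_gen fn.
  rewrite /= φf.
  apply: gtens_comm => //; first exact: (SUq2_ep_comm A_calc fn).
  by rewrite -[LHS]mulrA τu [LHS]mulrA τu [RHS]mulrA.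
- move=> f n fn; have [u [φf hu _ τu _]] := coact_forms_gen fn.
  rewrite /= φf.
  apply: gtens_comm => //; first exact: (SUq2_em_comm A_calc fn).
  by rewrite -[LHS]mulrA τu [LHS]mulrA τu [RHS]mulrA.
- move=> f n fn; have [u [φf hu _ _ θu]] := coact_forms_gen fn.
  rewrite /= φf mulrDl mulrDr scalerDr (gtensMr _ _ hθ (hA f)).
  rewrite (gtensMl _ _ hu (homog1 OmA)) mul1r mulr1 θu (bilinZr B); congr (_ + _).
  apply: gtens_comm (homog1 OmH) _ _ _ => //; last by rewrite mulr1 mul1r.
  exact: (SUq2_e0_comm A_calc fn).
- rewrite (gtensMl _ _ hττ hm) (gtensMl _ _ hτVτV hp) τττV τVτVτ (SUq2_epem A_calc).
  exact: (bilinZl B).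
- apply: gtens_frame_zero_comm => //; first exact: (SUq2_epe0 A_calc).
  by rewrite θττ scalerA mulVf ?expf_neq0 // scale1r.
- apply: gtens_frame_zero_comm => //; first exact: (SUq2_eme0 A_calc).
  by rewrite θττV scalerA mulfV ?expf_neq0 // scale1r.
- by rewrite (gtensMl _ _ hττ hp) (SUq2_epep A_calc) (bilin0l B).
- by rewrite (gtensMl _ _ hτVτV hm) (SUq2_emem A_calc) (bilin0l B).
have h1 : homog 0 (1 : OmH) by exact: homog1.
rewrite mulrDr (frame_zero_mulr h0 h1) (SUq2_e0e0 A_calc) (bilin0l B) sub0r mulr1.
rewrite mulrDl (gtensMl _ _ h1 (homog1 OmA)) (gtensMr _ _ hθ (homog1 OmA)).
by rewrite theta_sq !mulr1 mul1r (bilin0r B) addr0 addNr.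
Qed.

Lemma coact_forms_complete : complete_calculus OmH OmA.
Proof.
have [f [fι fd]] := SUq2_calculus_extension A_calc q0 A_rel (OqSU2_gen A_SUq2)
  coact_forms_derivation coact_frame_rel.
exists f; last exact: fι.
by apply: dga_morphism_of_degree0 => x; rewrite fι //; exact: homog_coact_forms.
Qed.
End TensorCalculus.

(** * Completeness of the calculus *)

Theorem theorem4p3p16 (R : realType) (q : R[i]) (q_neq0 : q != 0)
    (H : hopf_algebra R[i]) (t tV : H) (H_OU1 : is_OU1 t tV)
    (OmH : calculus H) (OmH_calc : is_OU1_calculus q t OmH)
    (A : comodule_algebra H) (alpha beta gamma delta : A)
    (A_SUq2 : is_OqSU2 q t tV alpha beta gamma delta)
    (OmA : calculus A)
    (OmA_calc : is_SUq2_calculus q OmA alpha beta gamma delta) :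
  complete_calculus OmH OmA.
Proof.
exact: (coact_forms_complete q_neq0 H_OU1 OmH_calc A_SUq2 OmA_calc).
Qed.
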